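(* Let $\eta\in L^{2}(\mathcal{F}_{T};\mathbb{R}^{n})$ and let $f:\Omega\times\{1,\dots,T\}\times\mathbb{R}^{n}\times\mathbb{R}^{n\times d}\to\mathbb{R}^{n}$, with $f(t,y,z)$ being $\mathcal{F}_t$-measurable for all $(t,y,z)$, satisfy: (A1) there exist constants $c_1,c_2>0$ such that for all $t\in\{1,\dots,T-1\}$, $y_1,y_2\in\mathbb{R}^n$, $z_1,z_2\in\mathbb{R}^{n\times d}$, $P$-a.s., $$|f(T,y_1,z_1)-f(T,y_2,z_2)|\le c_1|y_1-y_2|,\qquad |f(t,y_1,z_1)-f(t,y_2,z_2)|\le c_1|y_1-y_2|+c_2\|z_1-z_2\|$$ (in particular $f(T,y,z)$ does not depend on $z$); (A2) $f(t,0,0)\in L^{2}(\mathcal{F}_t;\mathbb{R}^n)$ for every $t\in\{1,\dots,T\}$. Then the backward stochastic difference equation $$\Delta Y_t=-f(t+1,Y_{t+1},Z_{t+1})+Z_t\Delta W_t+\Delta N_t,\quad t\in\{0,\dots,T-1\},\qquad Y_T=\eta,$$ has a unique adapted solution $(Y,Z,N)$.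
   Context: Let $T\ge 1$ be an integer and $(\Omega,\mathcal{F},\{\mathcal{F}_t\}_{0\le t\le T},P)$ a filtered probability space in discrete time $t\in\{0,1,\dots,T\}$, with $\mathcal{F}_0$ trivial (up to $P$-null sets) and $\mathcal{F}=\mathcal{F}_T$. For an adapted process $U$, $\Delta U_t=U_{t+1}-U_t$. $W$ is a fixed $\mathbb{R}^d$-valued square integrable martingale with independent increments: $\mathbb{E}[\Delta W_t|\mathcal{F}_t]=\mathbb{E}[\Delta W_t]=0$ and $\mathbb{E}[\Delta W_t(\Delta W_t)^*]=I_d$ for $t\in\{0,\dots,T-1\}$, where $^*$ denotes transposition. $\mathcal{F}_t$ is the completion of the $\sigma$-algebra generated by $W$ up to time $t$. $L^2(\mathcal{F}_t;\mathbb{R}^n)$ is the set of $\mathcal{F}_t$-measurable square integrable $\mathbb{R}^n$-valued random variables; $\mathcal{M}^2(s,t;E)$ is the set of adapted square integrable $E$-valued processes indexed by $\{s,\dots,t\}$. $|\cdot|$ is the Euclidean norm and $\|\cdot\|$ the Frobenius norm of matrices. A solution is a triple $(Y,Z,N)\in\mathcal{M}^2(0,T;\mathbb{R}^n)\times\mathcal{M}^2(0,T-1;\mathbb{R}^{n\times d})\times\mathcal{M}^2(0,T;\mathbb{R}^n)$ satisfying the equation $P$-a.s. for all $t\in\{0,\dots,T-1\}$ and the terminal condition, where $N$ is a martingale strongly orthogonal to $W$ (i.e. $N_tW_t^*$ is a matrix-valued martingale), normalized by $N_0=0$. Since $f(T,y,z)$ does not depend on $z$, no value $Z_T$ is needed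 at $t=T-1$. Processes are identified if equal $P$-a.s. at each time.
   Formalization: In (A1) the P-null exceptional set is taken to be the same for all y1, y2, z1, z2 (f(t,·,·) is a.s. Lipschitz); if it may depend on y1, y2, z1, z2, then f(t,Y_t,Z_t) need not be measurable and a solution may fail to exist. *)

(* Defs.v *)
From HB Require Import structures.
From mathcomp Require Import all_boot all_order all_algebra.
From mathcomp Require Import all_classical all_reals all_analysis.

Set Implicit Arguments.
Unset Strict Implicit.
Unset Printing Implicit Defensive.

Import Order.TTheory GRing.Theory Num.Theory.
Import numFieldNormedType.Exports.

Local Open Scope classical_set_scope.
Local Open Scope ring_scope.

(* Vectors of R^n are columns 'cV[R]_n.  The library norm `|A| of a matrix is
   the maximum of the absolute values of its entries; the norm below is the
   Frobenius norm, which on columns is the Euclidean norm. *)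
Definition frobenius (R : realType) (m n : nat) (A : 'M[R]_(m, n)) : R :=
  Num.sqrt (\sum_(i < m) \sum_(j < n) A i j ^+ 2).

Definition increment (V : zmodType) (Omega : Type) (U : nat -> Omega -> V)
  (t : nat) : Omega -> V := fun w => U t.+1 w - U t w.

Section RandomMatrices.
Context (d : measure_display) (Omega : measurableType d) (R : realType).
Context (P : probability Omega R).

(* These sets generate sigma(X): the Borel sigma-algebra of R^(m x n) is the
   product one. *)
Definition entry_events (m n : nat) (X : Omega -> 'M[R]_(m, n)) :
    set (set Omega) :=
  [set A | exists i j, exists2 B : set R,
     measurable B & A = (fun w => X w i j) @^-1` B].

Definition sigma_of (m n : nat) (X : Omega -> 'M[R]_(m, n)) :
    set (set Omega) :=
  <<s entry_events X >>.

(* In what follows G is a sub-sigma-algebra of the one of Omega; then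
   g_sigma_algebraType G is Omega equipped with G itself.  Measurability for
   the Borel sigma-algebra of R^(m x n) is measurability of the entries. *)
Definition measurable_wrt (G : set (set Omega)) (m n : nat)
    (X : Omega -> 'M[R]_(m, n)) : Prop :=
  forall i j,
    measurable_fun [set: g_sigma_algebraType G]
      ((fun w => X w i j) : g_sigma_algebraType G -> R).

Definition L2 (G : set (set Omega)) (m n : nat) (X : Omega -> 'M[R]_(m, n)) :
    Prop :=
  measurable_wrt G X /\ ('E_P[fun w => (frobenius (X w) ^+ 2)%R] < +oo)%E.

Definition mx_integrable (m n : nat) (X : Omega -> 'M[R]_(m, n)) : Prop :=
  forall i j, P.-integrable [set: Omega] (fun w => (X w i j)%:E).

(* V is a version of E[X | G]. *)
Definition is_condexp (G : set (set Omega)) (m n : nat)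
    (X V : Omega -> 'M[R]_(m, n)) : Prop :=
  [/\ mx_integrable X, mx_integrable V, measurable_wrt G V &
      forall A, G A -> forall i j,
        (\int[P]_(w in A) (X w i j)%:E = \int[P]_(w in A) (V w i j)%:E)%E].

Definition independent_sigma (G H : set (set Omega)) : Prop :=
  forall A B, G A -> H B -> (P (A `&` B) = P A * P B)%E.

Definition trivial_sigma (G : set (set Omega)) : Prop :=
  forall A, G A -> (P A = 0 \/ P A = 1)%E.

(* The sigma-algebra generated by W_0, ..., W_t, completed with the P-null
   sets (the subsets of measurable sets of probability zero). *)
Definition completed_filtration (m n : nat) (W : nat -> Omega -> 'M[R]_(m, n))
    (t : nat) : set (set Omega) :=
  <<s (\bigcup_(s in [set s | (s <= t)%N]) entry_events (W s))
      `|` [set A | P.-negligible A] >>.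

(* Processes are functions on nat of which only the values at the relevant
   times matter: here U_a, ..., U_b. *)
Definition M2 (F : nat -> set (set Omega)) (a b m n : nat)
    (U : nat -> Omega -> 'M[R]_(m, n)) : Prop :=
  forall t, (a <= t <= b)%N -> L2 (F t) (U t).

Definition martingale (F : nat -> set (set Omega)) (T m n : nat)
    (M : nat -> Omega -> 'M[R]_(m, n)) : Prop :=
  [/\ forall t, (t <= T)%N -> measurable_wrt (F t) (M t),
      forall t, (t <= T)%N -> mx_integrable (M t) &
      forall s t, (s <= t <= T)%N -> is_condexp (F s) (M t) (M s)].

Record driving_martingale (F : nat -> set (set Omega)) (T k : nat)
    (W : nat -> Omega -> 'cV[R]_k) : Prop := {
  driving_M2 : M2 F 0 T W;
  driving_martingaleP : martingale F T W;
  driving_indep : forall t, (t < T)%N ->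
    independent_sigma (F t) (sigma_of (increment W t));
  driving_condexp : forall t, (t < T)%N ->
    is_condexp (F t) (increment W t) (fun=> 0);
  driving_mean : forall t, (t < T)%N -> forall i j,
    ('E_P[fun w => increment W t w i j] = 0)%E;
  driving_cov : forall t, (t < T)%N -> forall i j,
    ('E_P[fun w => ((increment W t w *m (increment W t w)^T) i j)%R]
      = ((1%:M : 'M[R]_k) i j)%:E)%E }.

Definition strongly_orthogonal (F : nat -> set (set Omega)) (T n k : nat)
    (N : nat -> Omega -> 'cV[R]_n) (W : nat -> Omega -> 'cV[R]_k) : Prop :=
  martingale F T (fun t w => N t w *m (W t w)^T).

(* Z_T occurs in the equation at t = T - 1 only as an argument of f T, and is
   left unconstrained: the theorem assumes that f T does not depend on it. *)
Record bsde_solution (F : nat -> set (set Omega)) (T n k : nat)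
    (W : nat -> Omega -> 'cV[R]_k)
    (f : Omega -> nat -> 'cV[R]_n -> 'M[R]_(n, k) -> 'cV[R]_n)
    (eta : Omega -> 'cV[R]_n)
    (Y : nat -> Omega -> 'cV[R]_n) (Z : nat -> Omega -> 'M[R]_(n, k))
    (N : nat -> Omega -> 'cV[R]_n) : Prop := {
  sol_Y : M2 F 0 T Y;
  sol_Z : M2 F 0 T.-1 Z;
  sol_N : M2 F 0 T N;
  sol_N_martingale : martingale F T N;
  sol_N_orthogonal : strongly_orthogonal F T N W;
  sol_N0 : {ae P, forall w, N 0%N w = 0};
  sol_eq : forall t, (t < T)%N -> {ae P, forall w,
    increment Y t w = - f w t.+1 (Y t.+1 w) (Z t.+1 w)
                      + Z t w *m increment W t w + increment N t w};
  sol_terminal : {ae P, forall w, Y T w = eta w} }.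

End RandomMatrices.

(* Main.v *)
Require Import Defs.
From HB Require Import structures.
From mathcomp Require Import all_boot all_order all_algebra.
From mathcomp Require Import all_classical all_reals all_analysis.
From mathcomp Require Import measurable_realfun ring lra.

Set Implicit Arguments.
Unset Strict Implicit.
Unset Printing Implicit Defensive.

Import Order.TTheory GRing.Theory Num.Theory.
Import numFieldNormedType.Exports.

Local Open Scope classical_set_scope.
Local Open Scope ring_scope.

(* Put X = Y_{t+1} + f(t+1, Y_{t+1}, Z_{t+1}).  The equation at time t is the
   decomposition X = Y_t + Z_t dW_t + dN_t, where dN_t is conditionally centered
   and conditionally uncorrelated with dW_t.  Since the covariance of dW_t given
   F_t is the identity, this forces Y_t = E[X | F_t] and
   Z_t = E[X dW_t^* | F_t], and these formulas define a solution; so existence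
   and uniqueness both follow by backward induction on t.

   Conditional expectations come from the Radon-Nikodym theorem, and are handled
   through the relation [ccentered P G D], i.e. E[D | G] = 0. *)

(** * Conditionally centered random variables *)

(** The delicate point is square integrability. For [X] and [D] in L^2 the product is a priori only
    integrable, so that Z_t = E[X dW_t^* | F_t] lies in L^2 rests on the conditional Cauchy-Schwarz
    inequality E[XD | G]^2 <= E[X^2 | G] E[D^2 | G] with E[D^2 | G] = 1. The same constant
    conditional variance keeps Z_t dW_t in L^2. The covariance of dW_t is given in mean only; its
    independence of F_t makes the identity conditional.

    No fixed point arises, because the driver is evaluated at time t+1. The Lipschitz condition
    turns f(t, Y_t, Z_t) into an L^2 variable: f is measurable only for fixed (y, z) and its bounds
    hold off null sets, whence the use of complete sigma-algebras.

    E[X | G] = V means that V is G-measurable and X - V is centered. Centered variables form a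
    vector space stable under G-measurable multipliers as long as the product is integrable, so most
    arguments become algebraic identities. *)

Section SubSigmaAlgebra.
Context (dO : measure_display) (Omega : measurableType dO) (R : realType).
Context (P : probability Omega R).
Implicit Types (G : set (set Omega)) (X Y D U V : Omega -> R).

Definition meas_wrt G U :=
  measurable_fun [set: g_sigma_algebraType G]
    (U : g_sigma_algebraType G -> R).

Definition sub_sigma G := sigma_algebra [set: Omega] G /\ G `<=` measurable.

Definition ccentered G D :=
  P.-integrable [set: Omega] (EFin \o D) /\
  forall A, G A -> (\int[P]_(w in A) (D w)%:E = 0)%E.

Lemma sub_sigmaE G A : sub_sigma G ->
  G A = @measurable _ (g_sigma_algebraType G) A.
Proof. by move=> [sG _]; rewrite /measurable/= (sigma_algebra_id sG). Qed.

Lemma meas_wrt_measurable G U : sub_sigma G -> meas_wrt G U ->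
  measurable_fun [set: Omega] U.
Proof.
move=> [sG Gm] mU _ B mB; apply: Gm; rewrite -(sigma_algebra_id sG).
exact: mU measurableT B mB.
Qed.

Lemma meas_wrt_set G U B : sub_sigma G -> meas_wrt G U -> measurable B ->
  G (U @^-1` B).
Proof.
move=> [sG Gm] mU mB; rewrite -(sigma_algebra_id sG) -[_ @^-1` _]setTI.
exact: mU measurableT B mB.
Qed.

Lemma meas_wrtP G U : sub_sigma G ->
  (forall B, measurable B -> G (U @^-1` B)) -> meas_wrt G U.
Proof.
move=> [sG Gm] mU _ B mB; rewrite setTI.
suff : <<s G >> (U @^-1` B) by [].
rewrite (sigma_algebra_id sG); exact: mU.
Qed.

Lemma meas_wrt_sub G H U : sub_sigma G -> sub_sigma H -> G `<=` H ->
  meas_wrt G U -> meas_wrt H U.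
Proof.
by move=> sG sH GH mU; apply: meas_wrtP => // B mB; apply: GH; exact: meas_wrt_set.
Qed.

Import HBNNSimple.

(** [h] is simple for [G] itself, so its level sets are events of [G], on which integrals of [X] can
    be compared. *)
Lemma integral_nnsfun_mul G (h : {nnsfun (g_sigma_algebraType G) >-> R}) X :
  sub_sigma G -> measurable_fun [set: Omega] X -> (forall w, 0 <= X w) ->
  (\int[P]_w (h w * X w)%:E =
   \sum_(y \in range h) y%:E * \int[P]_(w in h @^-1` [set y]) (X w)%:E)%E.
Proof.
move=> sG mX X0.
have mh : forall y, @measurable _ Omega (h @^-1` [set y]).
  move=> y; apply: (sG.2); apply: meas_wrt_set => //.
  exact: (@measurable_funPT _ _ _ _ h).
have mI y : measurable_fun [set: Omega] (\1_(h @^-1` [set y]) : Omega -> R).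
  exact: measurable_indic.
transitivity (\int[P]_w (\sum_(y \in range h)
    ((y * \1_(h @^-1` [set y]) w)%:E * (X w)%:E)))%E.
  apply: eq_integral => w _; rewrite [in LHS](fimfunE h) EFinM -fsumEFin//.
  by rewrite ge0_mule_fsuml// => y; rewrite EFinM nnfun_muleindic_ge0.
rewrite ge0_integral_fsum//; last 2 first.
- move=> y; apply: emeasurable_funM; apply/measurable_EFinP => //.
  exact: measurable_funM.
- by move=> y w _; apply: mule_ge0; [rewrite EFinM nnfun_muleindic_ge0|rewrite lee_fin].
apply: eq_fsbigr => y; rewrite inE => -[t _ hty].
have y0 : 0 <= y by rewrite -hty.
under eq_integral do rewrite EFinM -muleA.
rewrite ge0_integralZl//.
- congr (_ * _)%E; rewrite [RHS]integral_mkcond; apply: eq_integral => w _.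
  by rewrite epatch_indic/= muleC.
- by apply: emeasurable_funM; apply/measurable_EFinP.
- by move=> w _; rewrite mule_ge0// lee_fin.
Qed.

(** Simple functions over [G] increase to [U], and monotone convergence passes to the limit.
    Nonnegativity lets both sides be infinite, so the lemma can also be used to prove that an
    integral is finite. *)
Lemma eq_integral_mul G X Y U : sub_sigma G ->
  measurable_fun [set: Omega] X -> (forall w, 0 <= X w) ->
  measurable_fun [set: Omega] Y -> (forall w, 0 <= Y w) ->
  (forall A, G A ->
    \int[P]_(w in A) (X w)%:E = \int[P]_(w in A) (Y w)%:E)%E ->
  meas_wrt G U -> (forall w, 0 <= U w) ->
  (\int[P]_w (U w * X w)%:E = \int[P]_w (U w * Y w)%:E)%E.
Proof.
move=> sG mX X0 mY Y0 XY mU U0.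
have mU' : measurable_fun [set: g_sigma_algebraType G] (EFin \o U).
  exact/measurable_EFinP.
pose h := nnsfun_approx (@measurableT _ (g_sigma_algebraType G)) mU'.
have mh n : meas_wrt G (h n) by exact: (@measurable_funPT _ _ _ _ (h n)).
have intE V : measurable_fun [set: Omega] V -> (forall w, 0 <= V w) ->
    (\int[P]_w (U w * V w)%:E = limn (fun n => \int[P]_w (h n w * V w)%:E))%E.
  move=> mV V0; rewrite -monotone_convergence//.
  - apply: eq_integral => w _; apply/esym/cvg_lim => //.
    rewrite EFinM; under eq_fun do rewrite EFinM.
    apply: cvgeZr => //.
    by apply: (@cvg_nnsfun_approx _ _ _ _ _ _ mU') => // x _; rewrite lee_fin.
  - move=> n; apply/measurable_EFinP/measurable_funM => //.
    exact: meas_wrt_measurable sG (mh n).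
  - by move=> n w _; rewrite lee_fin mulr_ge0.
  - move=> w _ a b ab; rewrite lee_fin ler_wpM2r//.
    exact/(@lefP (g_sigma_algebraType G))/nd_nnsfun_approx.
rewrite !intE//; congr (limn _); apply/funext => n.
rewrite !integral_nnsfun_mul//; apply: eq_fsbigr => y _.
congr (_ * _)%E; apply: XY; exact: meas_wrt_set.
Qed.

End SubSigmaAlgebra.

(** * Integrability, and the calculus of conditionally centered variables *)

Section ConditionallyCentered.
Context (dO : measure_display) (Omega : measurableType dO) (R : realType).
Context (P : probability Omega R).
Implicit Types (G : set (set Omega)) (X Y D U V : Omega -> R).
Local Notation L1 X := (P.-integrable [set: Omega] (EFin \o X)).

Lemma L1_measurable X : L1 X -> measurable_fun [set: Omega] X.
Proof. by move=> /measurable_int/measurable_EFinP. Qed.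

Lemma L1D X Y : L1 X -> L1 Y -> L1 (fun w => X w + Y w).
Proof. by move=> iX iY; exact: (integrableD measurableT iX iY). Qed.

Lemma L1B X Y : L1 X -> L1 Y -> L1 (fun w => X w - Y w).
Proof. by move=> iX iY; exact: (integrableB measurableT iX iY). Qed.

Lemma L1Z c X : L1 X -> L1 (fun w => c * X w).
Proof. by move=> iX; exact: (integrableZl measurableT c iX). Qed.

Lemma L1_cst c : L1 (fun=> c).
Proof. exact: finite_measure_integrable_cst. Qed.

Lemma L1_le X Y : measurable_fun [set: Omega] X ->
  (forall w, `|X w| <= Y w) -> L1 Y -> L1 X.
Proof.
move=> mX XY iY; apply: (le_integrable measurableT _ _ iY).
  exact/measurable_EFinP.
move=> w _ /=; rewrite lee_fin (le_trans (XY w))//; exact: ler_norm.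
Qed.

Lemma L1_sum (I : Type) (s : seq I) (X : I -> Omega -> R) :
  (forall i, L1 (X i)) -> L1 (fun w => \sum_(i <- s) X i w).
Proof.
elim: s => [|i s IHs] iX.
  by under eq_fun do rewrite big_nil; exact: L1_cst.
by under eq_fun do rewrite big_cons; apply: L1D => //; exact: IHs.
Qed.

Lemma ccentered0 G : ccentered P G (fun=> 0).
Proof. by split; [exact: L1_cst|move=> A _; exact: integral0]. Qed.

Lemma ccenteredD G X Y : sub_sigma G -> ccentered P G X -> ccentered P G Y ->
  ccentered P G (fun w => X w + Y w).
Proof.
move=> sG [iX X0] [iY Y0]; split; first exact: L1D.
move=> A GA; have mA := sG.2 _ GA.
rewrite -[0%E]adde0 -[in X in (X + _)%E](X0 A GA) -[in RHS](Y0 A GA).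
by rewrite -integralD_EFin//; exact: integrableS measurableT mA _ _.
Qed.

Lemma ccenteredZ G c X : sub_sigma G -> ccentered P G X ->
  ccentered P G (fun w => c * X w).
Proof.
move=> sG [iX X0]; split; first exact: L1Z.
move=> A GA; have mA := sG.2 _ GA.
under eq_integral do rewrite EFinM.
rewrite integralZl ?X0 ?mule0//; exact: integrableS measurableT mA _ iX.
Qed.

Lemma ccenteredB G X Y : sub_sigma G -> ccentered P G X -> ccentered P G Y ->
  ccentered P G (fun w => X w - Y w).
Proof.
move=> sG cX cY; have := ccenteredD sG cX (ccenteredZ (-1) sG cY).
by under eq_fun do rewrite mulN1r.
Qed.

Lemma ccentered_sum G (I : Type) (s : seq I) (X : I -> Omega -> R) :
  sub_sigma G -> (forall i, ccentered P G (X i)) ->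
  ccentered P G (fun w => \sum_(i <- s) X i w).
Proof.
move=> sG cX; elim: s => [|i s IHs].
  by under eq_fun do rewrite big_nil; exact: ccentered0.
by under eq_fun do rewrite big_cons; exact: ccenteredD.
Qed.

(** This is the tower property for centered variables. *)
Lemma ccentered_sub G H X : G `<=` H -> ccentered P H X -> ccentered P G X.
Proof. by move=> GH [iX X0]; split => // A /GH; exact: X0. Qed.

(** Splitting the signed condition into two nonnegative densities gives it the form that
    [eq_integral_mul] accepts. *)
Lemma ccentered_posneg G D A : sub_sigma G -> ccentered P G D -> G A ->
  (\int[P]_(w in A) (D^\+ w)%:E = \int[P]_(w in A) (D^\- w)%:E)%E.
Proof.
move=> sG [iD D0] GA; have mA := sG.2 _ GA.
have iDA := integrableS measurableT mA (@subsetT _ _) iD.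
have ip := integrable_funrpos mA iDA; have im := integrable_funrneg mA iDA.
have := D0 A GA.
rewrite (_ : (fun w => (D w)%:E) = fun w => ((D^\+ w)%:E - (D^\- w)%:E)%E).
  rewrite integralB_EFin// => /eqP.
  by rewrite sube_eq ?add0e ?fin_num_adde_defl ?integrable_fin_num// => /eqP.
by apply/funext => w; rewrite -EFinB -[in LHS](funrposBneg D).
Qed.

(* (U D)^+ = U^+ D^+ + U^- D^- and (U D)^- = U^+ D^- + U^- D^+ have the same
   integral, because D^+ and D^- have the same integrals on G. *)
Lemma ccentered_integral_mul G D U : sub_sigma G -> ccentered P G D ->
  meas_wrt G U -> L1 (fun w => U w * D w) ->
  (\int[P]_w (U w * D w)%:E = 0)%E.
Proof.
move=> sG cD mGU iUD.
have mU := meas_wrt_measurable sG mGU.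
have mD := L1_measurable cD.1.
have mDp := measurable_funrpos mD; have mDm := measurable_funrneg mD.
have mUp := measurable_funrpos mU; have mUm := measurable_funrneg mU.
have Up0 := funrpos_ge0 U; have Um0 := funrneg_ge0 U.
have Dp0 := funrpos_ge0 D; have Dm0 := funrneg_ge0 D.
have UE w : U w = U^\+ w - U^\- w by rewrite -[in LHS](funrposBneg U).
have DE w : D w = D^\+ w - D^\- w by rewrite -[in LHS](funrposBneg D).
have nUE w : `|U w| = U^\+ w + U^\- w.
  by have /(congr1 (@^~ w)) /= <- := funrposDneg U.
have nDE w : `|D w| = D^\+ w + D^\- w.
  by have /(congr1 (@^~ w)) /= <- := funrposDneg D.
have iN : L1 (fun w => `|U w * D w|) by exact: integrable_norm.
pose p w := U^\+ w * D^\+ w + U^\- w * D^\- w.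
pose m w := U^\+ w * D^\- w + U^\- w * D^\+ w.
(* [p + m = |U D|], so integrability of the product dominates both parts. *)
have iP : L1 p.
  apply: (L1_le _ _ iN); first by apply: measurable_funD; exact: measurable_funM.
  move=> w; rewrite normrM nUE nDE ger0_norm ?addr_ge0 ?mulr_ge0//.
  rewrite /p mulrDl !mulrDr.
  have := mulr_ge0 (Up0 w) (Dm0 w); have := mulr_ge0 (Um0 w) (Dp0 w); lra.
have iM : L1 m.
  apply: (L1_le _ _ iN); first by apply: measurable_funD; exact: measurable_funM.
  move=> w; rewrite normrM nUE nDE ger0_norm ?addr_ge0 ?mulr_ge0//.
  rewrite /m mulrDl !mulrDr.
  have := mulr_ge0 (Up0 w) (Dp0 w); have := mulr_ge0 (Um0 w) (Dm0 w); lra.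
have -> : (fun w => (U w * D w)%:E) = fun w => ((p w)%:E - (m w)%:E)%E.
  by apply/funext => w; rewrite -EFinB; congr EFin; rewrite UE DE /p /m; ring.
rewrite integralB_EFin//.
suff <- : (\int[P]_w (p w)%:E = \int[P]_w (m w)%:E)%E.
  by rewrite subee// integrable_fin_num.
have mGUp : meas_wrt G U^\+ by exact: measurable_funrpos.
have mGUm : meas_wrt G U^\- by exact: measurable_funrneg.
have e A : G A -> _ := fun GA => ccentered_posneg sG cD GA.
rewrite /p /m; under eq_integral do rewrite EFinD.
rewrite ge0_integralD//; last 4 first.
- by move=> w _; rewrite lee_fin mulr_ge0.
- exact/measurable_EFinP/measurable_funM.
- by move=> w _; rewrite lee_fin mulr_ge0.
- exact/measurable_EFinP/measurable_funM.
under [in RHS]eq_integral do rewrite EFinD.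
rewrite ge0_integralD//; last 4 first.
- by move=> w _; rewrite lee_fin mulr_ge0.
- exact/measurable_EFinP/measurable_funM.
- by move=> w _; rewrite lee_fin mulr_ge0.
- exact/measurable_EFinP/measurable_funM.
by congr (_ + _)%E; apply: (eq_integral_mul sG) => // A GA; rewrite e.
Qed.

Lemma meas_wrtM G U V : meas_wrt G U -> meas_wrt G V ->
  meas_wrt G (fun w => U w * V w).
Proof. exact: measurable_funM. Qed.

Lemma meas_wrtD G U V : meas_wrt G U -> meas_wrt G V ->
  meas_wrt G (fun w => U w + V w).
Proof. exact: measurable_funD. Qed.

Lemma meas_wrtB G U V : meas_wrt G U -> meas_wrt G V ->
  meas_wrt G (fun w => U w - V w).
Proof. exact: measurable_funB. Qed.

Lemma meas_wrt_cst G (c : R) : meas_wrt G (fun=> c).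
Proof. exact: measurable_cst. Qed.

Lemma meas_wrt_sum G (I : Type) (s : seq I) (X : I -> Omega -> R) :
  (forall i, meas_wrt G (X i)) -> meas_wrt G (fun w => \sum_(i <- s) X i w).
Proof. by move=> mX; apply: measurable_sum. Qed.

Lemma meas_wrt_indic G A : sub_sigma G -> G A -> meas_wrt G (\1_A : Omega -> R).
Proof.
move=> sG GA; apply: (@measurable_indic _ (g_sigma_algebraType G)).
by rewrite -sub_sigmaE.
Qed.

Lemma integral_indicM X A : measurable A ->
  (\int[P]_(w in A) (X w)%:E = \int[P]_w (\1_A w * X w)%:E)%E.
Proof.
move=> mA; rewrite integral_mkcond; apply: eq_integral => w _.
by rewrite epatch_indic/= muleC.
Qed.

(** For [A] in [G] the factor [\1_A * U] is again G-measurable, so an integral over [A] is a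
    whole-space integral of the kind just treated. *)
Lemma ccenteredM G D U : sub_sigma G -> ccentered P G D -> meas_wrt G U ->
  L1 (fun w => U w * D w) -> ccentered P G (fun w => U w * D w).
Proof.
move=> sG cD mU iUD; split => // A GA; have mA := sG.2 _ GA.
rewrite integral_indicM//; under eq_integral do rewrite mulrA.
apply: (ccentered_integral_mul sG cD).
  by apply: meas_wrtM => //; exact: meas_wrt_indic.
have mI : measurable_fun [set: Omega] (\1_A : Omega -> R) by exact: measurable_indic.
apply: (@L1_le _ (fun w => `|U w * D w|)); last exact: integrable_norm.
  under eq_fun do rewrite -mulrA.
  by apply: measurable_funM => //; exact: L1_measurable.
move=> w; rewrite -mulrA normrM ler_piMl// ger0_norm ?indicE //.
by case: (_ \in _).
Qed.

(** Measurability refers to the ambient sigma-algebra: increments from t to t+1 are square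
    integrable without being F_t-measurable. *)
Definition sqint X :=
  measurable_fun [set: Omega] X /\ L1 (fun w => X w ^+ 2).

(** Domination is almost sure, as are the Lipschitz bounds on the driver. *)
Lemma sqint_le X Y : measurable_fun [set: Omega] X ->
  {ae P, forall w, `|X w| <= Y w} -> sqint Y -> sqint X.
Proof.
move=> mX XY [mY iY]; have mX2 : measurable_fun [set: Omega] (fun w => X w ^+ 2).
  exact: measurable_funX.
split => //; apply/integrableP; split; first exact/measurable_EFinP.
apply: le_lt_trans (integrable_lty measurableT iY).
apply: ae_ge0_le_integral => //.
- by apply: measurableT_comp => //; exact/measurable_EFinP.
- by move=> w _; rewrite lee_fin sqr_ge0.
- exact/measurable_EFinP/measurable_funX.
- apply: filterS XY => w XY _; rewrite /= lee_fin normrX lerXn2r ?nnegrE//.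
  exact: le_trans XY.
Qed.

Lemma sqint_cst c : sqint (fun=> c).
Proof. by split; [exact: measurable_cst|exact: L1_cst]. Qed.

Lemma sqintM X Y : sqint X -> sqint Y -> L1 (fun w => X w * Y w).
Proof.
move=> [mX iX] [mY iY]; apply: (L1_le _ _ (L1D iX iY)).
  exact: measurable_funM.
move=> w; rewrite ler_norml.
have := sqr_ge0 (X w + Y w); have := sqr_ge0 (X w - Y w).
have := sqr_ge0 (X w); have := sqr_ge0 (Y w).
rewrite !expr2; nra.
Qed.

Lemma sqint_L1 X : sqint X -> L1 X.
Proof.
by move=> sX; have := sqintM sX (sqint_cst 1); under eq_fun do rewrite mulr1.
Qed.

Lemma sqintD X Y : sqint X -> sqint Y -> sqint (fun w => X w + Y w).
Proof.
move=> sX sY; have [mX iX] := sX; have [mY iY] := sY.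
split; first exact: measurable_funD.
have := L1D (L1D iX iY) (L1Z 2 (sqintM sX sY)).
by congr (L1 _); apply/funext => w; ring.
Qed.

Lemma sqintZ c X : sqint X -> sqint (fun w => c * X w).
Proof.
move=> [mX iX]; split; first exact: measurable_funM.
by under eq_fun do rewrite exprMn; exact: L1Z.
Qed.

Lemma sqintB X Y : sqint X -> sqint Y -> sqint (fun w => X w - Y w).
Proof.
move=> sX sY; have := sqintD sX (sqintZ (-1) sY).
by under eq_fun do rewrite mulN1r.
Qed.

Lemma sqint_sum (I : Type) (s : seq I) (X : I -> Omega -> R) :
  (forall i, sqint (X i)) -> sqint (fun w => \sum_(i <- s) X i w).
Proof.
move=> sX; elim: s => [|i s IHs].
  by under eq_fun do rewrite big_nil; exact: sqint_cst.
by under eq_fun do rewrite big_cons; exact: sqintD.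
Qed.

(** A G-measurable [D] can be tested against itself, which yields E[D^2] = 0. Uniqueness rests on
    this. *)
Lemma ccentered_eq0 G D : sub_sigma G -> ccentered P G D -> meas_wrt G D ->
  sqint D -> {ae P, forall w, D w = 0}.
Proof.
move=> sG cD mD sD.
have := ccentered_integral_mul sG cD mD (sqintM sD sD).
rewrite (eq_integral (fun w => `|(D w * D w)%:E|%E)) => [/ae_eq_integral_abs|].
  have mDD : measurable_fun [set: Omega] (fun w => (D w * D w)%:E).
    by apply/measurable_EFinP/measurable_funM; exact: sD.1.
  move=> /(_ measurableT mDD); apply: filterS => w /(_ I) /= [] /eqP.
  by rewrite mulf_eq0 orbb => /eqP.
by move=> w _; rewrite abse_EFin ger0_norm// -expr2 sqr_ge0.
Qed.

End ConditionallyCentered.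

(** * Conditional expectation of square integrable variables *)

Section ConditionalExpectation.
Context (dO : measure_display) (Omega : measurableType dO) (R : realType).
Context (P : probability Omega R).
Implicit Types (G : set (set Omega)) (X Y D U V : Omega -> R).
Local Notation L1 X := (P.-integrable [set: Omega] (EFin \o X)).

(** Pushing [P] and the charge A |-> E[X 1_A] forward along the identity onto Omega equipped with
    [G] restricts both to [G]. Their Radon-Nikodym derivative is then G-measurable by
    construction. *)
Lemma condexp_exists G X : sub_sigma G -> L1 X ->
  exists V, [/\ meas_wrt G V, L1 V & ccentered P G (fun w => X w - V w)].
Proof.
move=> sG iX.
pose GT := g_sigma_algebraType G.
pose id_G : Omega -> GT := id.
have mid : measurable_fun [set: Omega] id_G.
  move=> _ B mB; rewrite setTI; apply: sG.2.
  by rewrite sub_sigmaE.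
have mG A : G A -> @measurable _ GT A by rewrite (sub_sigmaE A sG).
pose idm : {mfun Omega >-> GT} := mfun_Sub (mem_set mid).
pose mu : probability GT R := distribution P idm.
pose nu := pushforward (induced_charge iX) idm.
pose nuc0 : {charge set GT -> \bar R} := nu.
pose nuc : {charge set GT -> \bar R} := nuc0 mid.
have numu : nuc `<< mu.
  apply/null_content_dominatesP => A mA muA.
  have mA' : @measurable _ Omega A by rewrite -[A]setTI; apply: (mid) => //.
  apply: null_set_integral => //.
  apply: measurable_funTS; exact: measurable_int iX.
pose f := Radon_Nikodym nuc mu.
have f_fin x : f x \is a fin_num by exact: Radon_Nikodym_fin_num.
have if_ : mu.-integrable [set: GT] f by exact: Radon_Nikodym_integrable.
have mf : measurable_fun [set: GT] f := measurable_int _ if_.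
pose V : Omega -> R := fun w => fine (f w).
have fV w : f w = (V w)%:E by rewrite /V fineK.
have mV : meas_wrt G V by exact: measurableT_comp.
have iV : L1 V.
  apply/integrableP; split.
    exact/measurable_EFinP/(meas_wrt_measurable sG).
  move/integrableP : if_ => [_]; apply: le_lt_trans.
  rewrite ge0_integral_pushforward//; last exact: measurableT_comp.
  by rewrite le_eqVlt; apply/orP; left; apply/eqP/eq_integral => w _ /=; rewrite fV.
exists V; split => //; split; first exact: L1B.
move=> A GA; have mA := sG.2 _ GA.
have iXA := integrableS measurableT mA (@subsetT _ _) iX.
have iVA := integrableS measurableT mA (@subsetT _ _) iV.
under eq_integral do rewrite EFinB.
rewrite integralB_EFin//.
suff -> : (\int[P]_(w in A) (X w)%:E = \int[P]_(w in A) (V w)%:E)%E.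
  by rewrite subee// integrable_fin_num.
transitivity (nuc A) => //.
rewrite (Radon_Nikodym_integral numu (mG A GA)).
rewrite integral_pushforward//; last exact: mG.
  by apply: eq_integral => w _ /=; rewrite -fV.
apply: eq_integrable iVA => // w _ /=; by rewrite -fV.
Qed.

Lemma L1_boundedM U X c : measurable_fun [set: Omega] U ->
  (forall w, `|U w| <= c) -> L1 X -> L1 (fun w => U w * X w).
Proof.
move=> mU Uc iX; have := L1Z c (integrable_norm iX); apply: L1_le.
  by apply: measurable_funM => //; exact: L1_measurable iX.
by move=> w; rewrite normrM ler_wpM2r.
Qed.

(* For bounded U = V 1_(|V| <= n), the square (X - U D)^2 equals
   X^2 - U^2 - 2 U (X D - V) + U^2 (D^2 - 1), whose last two terms have
   integral 0; hence E[U^2] <= E[X^2]. *)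
Lemma sqint_condexp G X D V : sub_sigma G -> sqint P X -> sqint P D ->
  ccentered P G (fun w => D w ^+ 2 - 1) -> meas_wrt G V ->
  ccentered P G (fun w => X w * D w - V w) -> sqint P V.
Proof.
move=> sG sX sD cD mV cV.
have mV' := meas_wrt_measurable sG mV.
split => //; apply/integrableP; split.
  exact/measurable_EFinP/measurable_funX.
under eq_integral do rewrite /= ger0_norm ?sqr_ge0//.
pose F n := [set w | `|V w| <= n%:R].
have GF n : G (F n).
  rewrite (_ : F n = V @^-1` `[- n%:R, n%:R]).
    by apply: meas_wrt_set => //; exact: measurable_itv.
  by apply/seteqP; split => w; rewrite /F /= in_itv /= ler_norml.
have mF n := sG.2 _ (GF n).
apply: (@le_lt_trans _ _ (\int[P]_w (X w ^+ 2)%:E)%E); last first.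
  exact: integrable_lty sX.2.
have FT : [set: Omega] = \bigcup_n F n.
  apply/esym/seteqP; split => // w _.
  by exists (Num.truncn `|V w|).+1 => //=; apply/ltW/truncnS_gt.
have mV2 : measurable_fun [set: Omega] (fun w => (V w ^+ 2)%:E).
  exact/measurable_EFinP/measurable_funX.
(* The integrals of V^2 over the increasing sets [F n] tend to the full integral, so a bound uniform
   in n suffices. Truncation makes the products with [U] below integrable. *)
rewrite [in X in (X <= _)%E]FT.
have ndF : nondecreasing_seq F.
  move=> n m nm; apply/subsetPset => w /= /le_trans; apply.
  by rewrite ler_nat.
have cvF := @ge0_nondecreasing_set_cvg_integral _ _ _ F _ P ndF mF.
rewrite -(cvg_lim _ (cvF (fun w => (V w ^+ 2)%:E) _ _)); last 3 first.
- by [].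
- by move=> n; exact: measurable_funTS.
- by move=> n w _; rewrite lee_fin sqr_ge0.
apply: lime_le.
  apply/cvg_ex; eexists; apply: cvF.
    by move=> n; exact: measurable_funTS.
  by move=> n w _; rewrite lee_fin sqr_ge0.
apply: nearW => n.
pose U w := \1_(F n) w * V w.
have mGU : meas_wrt G U by apply: meas_wrtM => //; exact: meas_wrt_indic.
have mU := meas_wrt_measurable sG mGU.
have Un w : `|U w| <= n%:R.
  rewrite /U indicE; case: (boolP (w \in F n)) => [|_]; rewrite ?inE.
    by move=> wF; rewrite mul1r.
  by rewrite mul0r normr0.
have Un2 w : `|U w * U w| <= n%:R * n%:R.
  by rewrite normrM ler_pM.
have UV w : U w * V w = U w ^+ 2.
  by rewrite /U indicE; case: (w \in F n); rewrite ?mul1r ?mul0r ?expr2 ?mul0r.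
rewrite integral_indicM//.
have -> : (\int[P]_w (\1_(F n) w * V w ^+ 2)%:E = \int[P]_w (U w ^+ 2)%:E)%E.
  by apply: eq_integral => w _; rewrite -UV /U expr2 mulrA.
pose E w := 2 * (U w * (X w * D w - V w)) - U w * U w * (D w ^+ 2 - 1).
have cE : ccentered P G E.
  apply: ccenteredB => //.
    apply: ccenteredZ => //; apply: ccenteredM => //.
    exact: L1_boundedM mU Un cV.1.
  apply: ccenteredM => //; first exact: meas_wrtM.
  by apply: L1_boundedM Un2 cD.1; exact: measurable_funM.
pose S w := (X w - U w * D w) ^+ 2.
have iU2 : L1 (fun w => U w ^+ 2).
  have := L1_boundedM (measurable_funM mU mU) Un2 (L1_cst P 1).
  by under eq_fun do rewrite mulr1.
have SE w : X w ^+ 2 - E w = U w ^+ 2 + S w.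
  by rewrite /E mulrBr UV /S; ring.
have -> : (\int[P]_w (X w ^+ 2)%:E = \int[P]_w (U w ^+ 2 + S w)%:E)%E.
  under [RHS]eq_integral do rewrite -SE EFinB.
  rewrite integralB_EFin//; last 2 first.
  - exact: sX.2.
  - exact: cE.1.
  have GT : G [set: Omega].
    by have [[G0 GC _] _] := sG; rewrite -[setT]setD0; exact: GC.
  by rewrite (cE.2 _ GT) sube0.
apply: ge0_le_integral => //.
- by move=> w _; rewrite lee_fin sqr_ge0.
- exact/measurable_EFinP/L1_measurable/iU2.
- apply/measurable_EFinP/(@L1_measurable _ _ _ P).
  under eq_fun do rewrite -SE.
  by apply: L1B; [exact: sX.2|exact: cE.1].
- by move=> w _; rewrite lee_fin lerDl sqr_ge0.
Qed.

(** E[Z^2 D^2] = E[Z^2 E[D^2 | G]] = E[Z^2]. The nonnegative form of the product rule applies before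
    the left side is known to be finite. *)
Lemma sqint_meas_wrtM G Z D : sub_sigma G -> meas_wrt G Z -> sqint P Z ->
  measurable_fun [set: Omega] D ->
  ccentered P G (fun w => D w ^+ 2 - 1) -> sqint P (fun w => Z w * D w).
Proof.
move=> sG mZ sZ mD cD.
have mZD : measurable_fun [set: Omega] (fun w => Z w * D w).
  by apply: measurable_funM => //; exact: sZ.1.
split => //; apply/integrableP; split.
  exact/measurable_EFinP/measurable_funX.
under eq_integral do rewrite /= ger0_norm ?sqr_ge0// exprMn expr2.
rewrite (eq_integral_mul sG (Y := fun=> 1)).
- under eq_integral do rewrite mulr1.
  exact: integrable_lty sZ.2.
- exact: measurable_funX.
- by move=> w; rewrite sqr_ge0.
- exact: measurable_cst.
- by [].
- move=> A GA; have mA := sG.2 _ GA.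
  have iA := integrableS measurableT mA (@subsetT _ _) cD.1.
  have i1 := integrableS measurableT mA (@subsetT _ _) (L1_cst P 1).
  have -> : (\int[P]_(w in A) (D w ^+ 2)%:E =
             \int[P]_(w in A) ((D w ^+ 2 - 1)%:E + 1%:E))%E.
    by apply: eq_integral => w _; rewrite -EFinD subrK.
  rewrite (integralD_EFin mA iA i1) (cD.2 A GA) add0e//.
- exact: meas_wrtM.
- by move=> w; rewrite -expr2 sqr_ge0.
Qed.

End ConditionalExpectation.

(** * From independence to conditional centering *)

Section Independence.
Context (dO : measure_display) (Omega : measurableType dO) (R : realType).
Context (P : probability Omega R).
Implicit Types (G : set (set Omega)) (X Y D U V : Omega -> R).
Local Notation L1 X := (P.-integrable [set: Omega] (EFin \o X)).

(** The roles are exchanged: for [A] in [G], independence makes [\1_A - P A] centered given [H].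
    Multiplying by the H-measurable [X] and integrating gives E[X 1_A] = c P(A). *)
Lemma ccentered_indep G H X c : sub_sigma G -> sub_sigma H ->
  independent_sigma P G H -> meas_wrt H X -> L1 X ->
  (\int[P]_w (X w)%:E = c%:E)%E -> ccentered P G (fun w => X w - c).
Proof.
move=> sG sH GH mX iX Xc; split; first by apply: L1B => //; exact: L1_cst.
move=> A GA; have mA := sG.2 _ GA.
have PA : (fine (P A))%:E = P A by rewrite fineK// fin_num_measure.
have mI : measurable_fun [set: Omega] (\1_A : Omega -> R) by exact: measurable_indic.
have iI : L1 (\1_A : Omega -> R) by exact: integrable_indic.
have ic r := L1_cst P r.
have cI : ccentered P H (fun w => \1_A w - fine (P A)).
  split; first by exact: L1B.
  move=> B HB; have mB := sH.2 _ HB.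
  under eq_integral do rewrite EFinB.
  rewrite integralB_EFin//; last 2 first.
  - exact: integrableS measurableT mB (@subsetT _ _) iI.
  - exact: integrableS measurableT mB (@subsetT _ _) (ic _).
  have -> : (\int[P]_(w in B) (\1_A w)%:E = P A * P B)%E.
    by rewrite integral_indic//; exact: GH.
  rewrite integral_cst// PA subee//.
  by rewrite fin_numM ?fin_num_measure.
have iXI : L1 (fun w => X w * \1_A w).
  have := L1_boundedM (c := 1) mI _ iX.
  under eq_fun do rewrite mulrC; apply => w.
  by rewrite indicE; case: (_ \in _); rewrite ?normr1 ?normr0.
have iXP : L1 (fun w => X w * fine (P A)).
  by under eq_fun do rewrite mulrC; exact: L1Z.
have iXc : L1 (fun w => X w * (\1_A w - fine (P A))).
  by under eq_fun do rewrite mulrBr; exact: L1B.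
have := ccentered_integral_mul sH cI mX iXc.
under eq_integral do rewrite mulrBr EFinB.
rewrite integralB_EFin// => /eqP.
rewrite sube_eq ?add0e ?fin_num_adde_defl ?integrable_fin_num// => /eqP XI.
under eq_integral do rewrite EFinB.
rewrite integralB_EFin//; last 2 first.
- exact: integrableS measurableT mA (@subsetT _ _) iX.
- exact: integrableS measurableT mA (@subsetT _ _) (ic _).
have -> : (\int[P]_(w in A) (X w)%:E = \int[P]_w (X w * \1_A w)%:E)%E.
  by rewrite integral_indicM//; apply: eq_integral => w _; rewrite mulrC.
rewrite XI; under eq_integral do rewrite EFinM.
by rewrite integralZr// Xc PA integral_cst// subee// fin_numM// fin_num_measure.
Qed.

End Independence.

(** * Random matrices *)

Section RandomMatrices.
Context (dO : measure_display) (Omega : measurableType dO) (R : realType).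
Context (P : probability Omega R).
Implicit Types (G : set (set Omega)) (X Y D U V : Omega -> R).
Local Notation L1 X := (P.-integrable [set: Omega] (EFin \o X)).

Lemma frobenius_ge0 m n (A : 'M[R]_(m, n)) : 0 <= frobenius A.
Proof. exact: sqrtr_ge0. Qed.

Lemma frobenius_sqr m n (A : 'M[R]_(m, n)) :
  frobenius A ^+ 2 = \sum_(i < m) \sum_(j < n) A i j ^+ 2.
Proof.
by rewrite sqr_sqrtr// !sumr_ge0// => i _; rewrite sumr_ge0// => j _; rewrite sqr_ge0.
Qed.

Lemma le_entry_frobenius m n (A : 'M[R]_(m, n)) i j : `|A i j| <= frobenius A.
Proof.
rewrite -ler_sqr ?nnegrE ?frobenius_ge0// frobenius_sqr real_normK ?num_real//.
rewrite (bigD1 i)//= (bigD1 j)//= -addrA lerDl addr_ge0//.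
  by rewrite sumr_ge0// => k _; rewrite sqr_ge0.
by rewrite sumr_ge0// => k _; rewrite sumr_ge0// => l _; rewrite sqr_ge0.
Qed.

Lemma frobenius_le_sum m n (A : 'M[R]_(m, n)) :
  frobenius A <= \sum_(i < m) \sum_(j < n) `|A i j|.
Proof.
have S0 (I : Type) (s : seq I) (a : I -> R) : (forall i, 0 <= a i) ->
    0 <= \sum_(i <- s) a i by move=> a0; rewrite sumr_ge0.
have sq (I : Type) (s : seq I) (a : I -> R) : (forall i, 0 <= a i) ->
    \sum_(i <- s) a i ^+ 2 <= (\sum_(i <- s) a i) ^+ 2.
  move=> a0; elim: s => [|i s IHs]; first by rewrite !big_nil expr0n.
  rewrite !big_cons; have := S0 _ s _ a0; have := a0 i; move: IHs.
  by rewrite !expr2; nra.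
have aS i : 0 <= \sum_(j < n) `|A i j| by exact: S0.
rewrite -ler_sqr ?nnegrE ?frobenius_ge0 ?S0// frobenius_sqr.
apply: le_trans (sq _ _ _ aS); apply: ler_sum => i _.
apply: le_trans (sq _ _ _ _) => //; apply: ler_sum => j _.
by rewrite real_normK ?num_real.
Qed.

Lemma frobenius0 p q : frobenius (0 : 'M[R]_(p, q)) = 0.
Proof.
rewrite /frobenius big1 ?sqrtr0// => i _; rewrite big1// => j _.
by rewrite mxE expr0n.
Qed.

Lemma frobenius_le0 p q (A : 'M[R]_(p, q)) : frobenius A <= 0 -> A = 0.
Proof.
move=> A0; apply/matrixP => i j; rewrite mxE; apply/eqP.
by rewrite -normr_le0; apply: le_trans A0; exact: le_entry_frobenius.
Qed.

Lemma L2P G m n (X : Omega -> 'M[R]_(m, n)) : sub_sigma G ->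
  L2 P G X <-> (measurable_wrt G X /\ forall i j, sqint P (fun w => X w i j)).
Proof.
move=> sG; split=> [[mX iX]|[mX sX]]; split => //.
  move=> i j; have mXij := meas_wrt_measurable sG (mX i j).
  split => //; apply/integrableP; split.
    exact/measurable_EFinP/measurable_funX.
  apply: le_lt_trans iX; rewrite unlock; apply: ge0_le_integral => //.
  - apply: measurableT_comp => //; exact/measurable_EFinP/measurable_funX.
  - apply/measurable_EFinP; under eq_fun do rewrite frobenius_sqr.
    apply: measurable_sum => k; apply: measurable_sum => l.
    by apply: measurable_funX; exact: meas_wrt_measurable sG (mX k l).
  - move=> w _; rewrite /= lee_fin normrX lerXn2r ?nnegrE ?frobenius_ge0//.
    exact: le_entry_frobenius.
have : L1 (fun w => frobenius (X w) ^+ 2).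
  under eq_fun do rewrite frobenius_sqr.
  by apply: L1_sum => i; apply: L1_sum => j; exact: (sX i j).2.
by move=> /integrable_lty; rewrite unlock; apply.
Qed.

Lemma L2D G m n (X Y : Omega -> 'M[R]_(m, n)) : sub_sigma G ->
  L2 P G X -> L2 P G Y -> L2 P G (fun w => X w + Y w).
Proof.
move=> sG /(L2P _ sG)[mX sX] /(L2P _ sG)[mY sY]; apply/(L2P _ sG).
split=> i j.
  by apply: eq_measurable_fun (meas_wrtD (mX i j) (mY i j)) => w _; rewrite !mxE.
by congr (sqint _ _): (sqintD (sX i j) (sY i j)); apply/funext => w; rewrite !mxE.
Qed.

Lemma L2B G m n (X Y : Omega -> 'M[R]_(m, n)) : sub_sigma G ->
  L2 P G X -> L2 P G Y -> L2 P G (fun w => X w - Y w).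
Proof.
move=> sG /(L2P _ sG)[mX sX] /(L2P _ sG)[mY sY]; apply/(L2P _ sG).
split=> i j.
  by apply: eq_measurable_fun (meas_wrtB (mX i j) (mY i j)) => w _; rewrite !mxE.
by congr (sqint _ _): (sqintB (sX i j) (sY i j)); apply/funext => w; rewrite !mxE.
Qed.

Lemma L2_0 G m n : sub_sigma G -> L2 P G (fun=> 0 : 'M[R]_(m, n)).
Proof.
move=> sG; apply/(L2P _ sG); split=> i j; first exact: measurable_cst.
exact: sqint_cst.
Qed.

Lemma L2_sub G H m n (X : Omega -> 'M[R]_(m, n)) :
  sub_sigma G -> sub_sigma H -> G `<=` H -> L2 P G X -> L2 P H X.
Proof.
move=> sG sH GH /(L2P _ sG)[mX sX]; apply/(L2P _ sH); split=> // i j.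
exact: (meas_wrt_sub sG sH GH (mX i j)).
Qed.

Lemma L2_mx_integrable G m n (X : Omega -> 'M[R]_(m, n)) : sub_sigma G ->
  L2 P G X -> mx_integrable P X.
Proof. by move=> sG /(L2P _ sG)[_ sX] i j; exact: sqint_L1. Qed.

Lemma is_condexpP G m n (X V : Omega -> 'M[R]_(m, n)) : sub_sigma G ->
  is_condexp P G X V <-> [/\ mx_integrable P X, mx_integrable P V,
    measurable_wrt G V & forall i j, ccentered P G (fun w => X w i j - V w i j)].
Proof.
move=> sG; split=> [[iX iV mV e]|[iX iV mV e]]; split => //.
  move=> i j; split; first by apply: L1B; [exact: iX|exact: iV].
  move=> A GA; have mA := sG.2 _ GA.
  under eq_integral do rewrite EFinB.
  have iVA := integrableS measurableT mA (@subsetT _ _) (iV i j).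
  rewrite integralB_EFin//; last exact: integrableS measurableT mA _ (iX i j).
  by rewrite e// subee// integrable_fin_num.
move=> A GA i j; have mA := sG.2 _ GA.
have iVA := integrableS measurableT mA (@subsetT _ _) (iV i j).
have iXA := integrableS measurableT mA (@subsetT _ _) (iX i j).
have := (e i j).2 _ GA; under eq_integral do rewrite EFinB.
rewrite integralB_EFin// => /eqP.
by rewrite sube_eq ?add0e ?fin_num_adde_defl ?integrable_fin_num// => /eqP.
Qed.

End RandomMatrices.

(** * Composition with a Lipschitz random function *)

Section LipschitzComposition.
Context (dO : measure_display) (Omega : measurableType dO) (R : realType).
Context (P : probability Omega R).
Implicit Types (G : set (set Omega)) (X Y D U V : Omega -> R).
Local Notation L1 X := (P.-integrable [set: Omega] (EFin \o X)).

Definition complete_sub G := sub_sigma G /\ forall N, P.-negligible N -> G N.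

(** The preimages under [U] and [V] differ only inside the negligible set where [U] and [V]
    disagree, and a complete [G] contains all its subsets. *)
Lemma meas_wrt_ae G U V : complete_sub G -> meas_wrt G U ->
  {ae P, forall w, U w = V w} -> meas_wrt G V.
Proof.
move=> [sG nG] mU UV; apply: meas_wrtP => // B mB.
have mE A := sub_sigmaE A sG.
pose N := [set w | U w <> V w].
have GN : G N by exact: nG.
have GNV : G (N `&` V @^-1` B).
  by apply: nG; apply: negligibleS UV; exact: subIsetl.
have GU : G (U @^-1` B) by exact: meas_wrt_set.
rewrite (_ : V @^-1` B = (U @^-1` B `\` N) `|` (N `&` V @^-1` B)).
  by move: GN GNV GU; rewrite !mE => GN GNV GU; apply: measurableU => //;
     exact: measurableD.
apply/seteqP; split => w /=.
  move=> VB; have [e|ne] := pselect (U w = V w); last by right.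
  by left; rewrite e; split => //; rewrite /N /=; apply.
by move=> [[UB]|[//]]; rewrite /N /= => /contrapT <-.
Qed.

(** A random field evaluated at a random index is measurable when the index takes countably many
    values, since the preimage splits over these values; joint measurability never enters. *)
Lemma meas_wrt_countable (I : countType) G (J : Omega -> I) (h : I -> Omega -> R) :
  sub_sigma G -> (forall i, G (J @^-1` [set i])) ->
  (forall i, meas_wrt G (h i)) -> meas_wrt G (fun w => h (J w) w).
Proof.
move=> sG GJ mh; apply: meas_wrtP => // B mB.
have mE A := sub_sigmaE A sG.
rewrite (_ : _ @^-1` B = \bigcup_i (J @^-1` [set i] `&` h i @^-1` B)).
  rewrite mE; apply: countable_bigcupT_measurable; first exact: countableP.
  by move=> i; apply: measurableI; rewrite -mE//; exact: meas_wrt_set.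
apply/seteqP; split => w /=; first by exists (J w).
by move=> [i _ [/= <-]].
Qed.

Section Discretization.
Variable m : nat.

(** Integer matrices form a countable type, as [meas_wrt_countable] requires of the index. *)
Definition discretize p q (A : 'M[R]_(p, q)) : 'M[int]_(p, q) :=
  \matrix_(i, j) Num.floor (m.+1%:R * A i j).

Definition undiscretize p q (A : 'M[int]_(p, q)) : 'M[R]_(p, q) :=
  \matrix_(i, j) ((A i j)%:~R / m.+1%:R).

Lemma frobenius_discretize p q (A : 'M[R]_(p, q)) :
  frobenius (undiscretize (discretize A) - A) <= (p * q)%:R * m.+1%:R^-1.
Proof.
apply: le_trans (frobenius_le_sum _) _.
apply: (@le_trans _ _ (\sum_(i < p) \sum_(j < q) m.+1%:R^-1)); last first.
  by rewrite !sumr_const !card_ord -mulrnA [leRHS]mulrC mulr_natr mulnC.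
apply: ler_sum => i _; apply: ler_sum => j _; rewrite !mxE.
have m0 : 0 < m.+1%:R :> R by [].
set x := A i j.
rewrite -(ler_pM2l m0) divff ?gt_eqF// -[X in X * `|_|]gtr0_norm// -normrM.
rewrite mulrBr mulrCA divff ?gt_eqF// mulr1.
have /andP[] := floor_itv (m.+1%:R * x); rewrite intrD => a b.
rewrite ler_norml; lra.
Qed.

Lemma discretize_set G p q (Y : Omega -> 'M[R]_(p, q)) B : sub_sigma G ->
  measurable_wrt G Y -> G ((fun w => discretize (Y w)) @^-1` [set B]).
Proof.
move=> sG mY.
have mE A := sub_sigmaE A sG.
rewrite (_ : _ @^-1` _ = \bigcap_(ij : 'I_p * 'I_q)
   ((fun w => m.+1%:R * Y w ij.1 ij.2) @^-1`
      `[(B ij.1 ij.2)%:~R, (B ij.1 ij.2 + 1)%:~R[)).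
  rewrite mE; apply: fin_bigcap_measurable => //= ij _.
  rewrite -mE; have mYij : meas_wrt G (fun w => m.+1%:R * Y w ij.1 ij.2).
    by apply: meas_wrtM; [exact: meas_wrt_cst|exact: mY].
  by apply: (meas_wrt_set sG mYij); exact: measurable_itv.
apply/seteqP; split => w /=.
  by move=> <- ij _; rewrite /= !mxE in_itv/= floor_itv.
move=> YB; apply/matrixP => i j; rewrite mxE.
by have := YB (i, j) Logic.I; rewrite /= in_itv/= => /floor_def.
Qed.

End Discretization.

(* Rounding Y and Z to multiples of 1/(m+1) makes them countably valued, so that
   w |-> h w (Y w) (Z w) is measurable for the rounded variables; the Lipschitz
   condition then gives convergence as m tends to infinity. *)
Lemma meas_wrt_compose G p q k l (h : Omega -> 'M[R]_(p, q) -> 'M[R]_(k, l) -> R)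
    (Y : Omega -> 'M[R]_(p, q)) (Z : Omega -> 'M[R]_(k, l)) (c1 c2 : R) :
  complete_sub G -> (forall y z, meas_wrt G (fun w => h w y z)) ->
  0 <= c1 -> 0 <= c2 ->
  {ae P, forall w, forall y1 y2 z1 z2, `|h w y1 z1 - h w y2 z2| <=
    c1 * frobenius (y1 - y2) + c2 * frobenius (z1 - z2)} ->
  measurable_wrt G Y -> measurable_wrt G Z ->
  meas_wrt G (fun w => h w (Y w) (Z w)).
Proof.
move=> cG mh c10 c20 hL mY mZ; have [sG nG] := cG.
have mE A := sub_sigmaE A sG.
pose good := [set w | forall y1 y2 z1 z2, `|h w y1 z1 - h w y2 z2| <=
    c1 * frobenius (y1 - y2) + c2 * frobenius (z1 - z2)].
(* The condition quantifies over uncountably many points; [good] is in [G] because its complement is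
   negligible. *)
have Ggood : G good.
  by rewrite mE -[good]setCK; apply: measurableC; rewrite -mE; exact: nG.
(* The indicator kills the points where the Lipschitz bound may fail, so convergence holds
   everywhere; [meas_wrt_ae] removes it afterwards. *)
pose g m w := \1_good w * h w (undiscretize m (discretize m (Y w)))
                              (undiscretize m (discretize m (Z w))).
have mg m : meas_wrt G (g m).
  apply: meas_wrtM; first exact: meas_wrt_indic.
  apply: (@meas_wrt_countable ('M[int]_(p, q) * 'M[int]_(k, l))%type G
    (fun w => (discretize m (Y w), discretize m (Z w)))
    (fun i w => h w (undiscretize m i.1) (undiscretize m i.2))) => //.
  move=> [B C].
  rewrite (_ : _ @^-1` _ = ((fun w => discretize m (Y w)) @^-1` [set B]) `&`
                           ((fun w => discretize m (Z w)) @^-1` [set C])).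
    by rewrite mE; apply: measurableI; rewrite -mE; exact: discretize_set.
  by apply/seteqP; split => w /= [-> ->].
apply: (@meas_wrt_ae _ (fun w => \1_good w * h w (Y w) (Z w))) => //; last first.
  apply: filterS hL => w hw; rewrite indicE mem_set ?mul1r//.
apply: (measurable_fun_cvg mg) => w _.
have [gw|ngw] := pselect (good w); last first.
  rewrite indicE memNset// mul0r; under eq_fun do rewrite /g indicE memNset// mul0r.
  exact: cvg_cst.
rewrite indicE mem_set// mul1r.
(* [C / (n+1)] is the Lipschitz bound applied to the rounding errors of [frobenius_discretize]. *)
pose C := c1 * (p * q)%:R + c2 * (k * l)%:R.
have Ch : C * harmonic n @[n --> \oo] --> C * (0 : R).
  by apply: cvgMr; exact: cvg_harmonic.
rewrite mulr0 in Ch.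
set x := h w (Y w) (Z w).
apply: (@squeeze_cvgr _ _ _ _ (fun n => x - C * harmonic n)
                              (fun n => x + C * harmonic n)).
- apply: nearW => m; rewrite -ler_distl /g indicE mem_set// mul1r.
  apply: le_trans (gw _ _ _ _) _.
  rewrite /C mulrDl lerD// -mulrA ler_wpM2l// frobenius_discretize//.
- by rewrite -[X in _ --> X]subr0; apply: cvgB => //; exact: cvg_cst.
- by rewrite -[X in _ --> X]addr0; apply: cvgD => //; exact: cvg_cst.
Qed.

Lemma sqint_frobenius G m n (X : Omega -> 'M[R]_(m, n)) : sub_sigma G ->
  L2 P G X -> sqint P (fun w => frobenius (X w)).
Proof.
move=> sG /(L2P _ _ sG)[mX sX].
have sS : sqint P (fun w => \sum_(i < m) \sum_(j < n) `|X w i j|).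
  apply: sqint_sum => i; apply: sqint_sum => j; have [mXij iXij] := sX i j.
  split; first exact: measurableT_comp.
  by under eq_fun do rewrite real_normK ?num_real//.
apply: sqint_le sS; last first.
  by apply: aeW => w; rewrite ger0_norm ?frobenius_ge0//; exact: frobenius_le_sum.
have -> : (fun w => frobenius (X w)) = (fun w =>
    Num.sqrt (\sum_(i < m) \sum_(j < n) X w i j ^+ 2)) by [].
apply: measurableT_comp.
  by apply: continuous_measurable_fun => x; exact: sqrt_continuous.
apply: measurable_sum => i; apply: measurable_sum => j.
by apply: measurable_funX; exact: (sX i j).1.
Qed.

(** Comparison with the point (0, 0) gives linear growth: each entry is at most [|h w 0 0 i 0| + c1
    * frobenius (Y w) + c2 * frobenius (Z w)] in absolute value. *)
Lemma L2_compose G p q k l n (h : Omega -> 'M[R]_(p, q) -> 'M[R]_(k, l) -> 'cV[R]_n)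
    (Y : Omega -> 'M[R]_(p, q)) (Z : Omega -> 'M[R]_(k, l)) (c1 c2 : R) :
  complete_sub G -> (forall y z, measurable_wrt G (fun w => h w y z)) ->
  0 <= c1 -> 0 <= c2 ->
  {ae P, forall w, forall y1 y2 z1 z2, frobenius (h w y1 z1 - h w y2 z2) <=
    c1 * frobenius (y1 - y2) + c2 * frobenius (z1 - z2)} ->
  L2 P G (fun w => h w 0 0) -> L2 P G Y -> L2 P G Z ->
  L2 P G (fun w => h w (Y w) (Z w)).
Proof.
move=> cG mh c10 c20 hL h0 LY LZ; have [sG nG] := cG.
have [mY _] := (L2P _ _ sG).1 LY; have [mZ _] := (L2P _ _ sG).1 LZ.
have sY := sqint_frobenius sG LY; have sZ := sqint_frobenius sG LZ.
have [m0 s0] := (L2P _ _ sG).1 h0.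
have hLi i : {ae P, forall w, forall y1 y2 z1 z2, `|h w y1 z1 i 0 - h w y2 z2 i 0| <=
    c1 * frobenius (y1 - y2) + c2 * frobenius (z1 - z2)}.
  apply: filterS hL => w hw y1 y2 z1 z2; apply: le_trans (hw y1 y2 z1 z2).
  by have := le_entry_frobenius (h w y1 z1 - h w y2 z2) i 0; rewrite !mxE.
have mhYZ i : meas_wrt G (fun w => h w (Y w) (Z w) i 0).
  apply: (meas_wrt_compose (h := fun w y z => h w y z i 0)) (hLi i) mY mZ => //.
  by move=> y z; exact: mh.
apply/(L2P _ _ sG); split=> i j; rewrite (ord1 j); first exact: mhYZ.
have sS : sqint P (fun w => `|h w 0 0 i 0| +
    (c1 * frobenius (Y w) + c2 * frobenius (Z w))).
  apply: sqintD; last by apply: sqintD; exact: sqintZ.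
  have [mhi ihi] := s0 i 0; split; first exact: measurableT_comp.
  by under eq_fun do rewrite real_normK ?num_real//.
apply: (sqint_le _ _ sS); first exact: meas_wrt_measurable sG (mhYZ i).
apply: filterS (hLi i) => w hw.
rewrite -[X in `|X|](subrK (h w 0 0 i 0)) (le_trans (ler_normD _ _))// addrC lerD//.
by have := hw (Y w) 0 (Z w) 0; rewrite !subr0.
Qed.

End LipschitzComposition.

(** * One step of the equation *)

Section OneStep.
Context (dO : measure_display) (Omega : measurableType dO) (R : realType).
Context (P : probability Omega R).
Implicit Types (G : set (set Omega)) (X Y D U V : Omega -> R).
Local Notation L1 X := (P.-integrable [set: Omega] (EFin \o X)).

Lemma ccentered_ae G X Y : sub_sigma G -> measurable_fun [set: Omega] Y ->
  {ae P, forall w, X w = Y w} -> ccentered P G X -> ccentered P G Y.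
Proof.
move=> sG mY XY [iX X0]; have mX := L1_measurable iX.
have e A : measurable A ->
    (\int[P]_(w in A) (Y w)%:E = \int[P]_(w in A) (X w)%:E)%E.
  move=> mA; apply: ae_eq_integral => //.
  - exact/measurable_EFinP/measurable_funTS.
  - exact/measurable_EFinP/measurable_funTS.
  - by apply: filterS XY => w -> _.
split; last by move=> A GA; rewrite e ?X0//; exact: sG.2.
apply/integrableP; split; first exact/measurable_EFinP.
move/integrableP : iX => [_]; apply: le_lt_trans.
rewrite le_eqVlt; apply/orP; left; apply/eqP; apply: ae_eq_integral => //.
- by apply: measurableT_comp => //; exact/measurable_EFinP.
- by apply: measurableT_comp => //; exact/measurable_EFinP.
- by apply: filterS XY => w /= -> _.
Qed.

(** What one step uses of dW_t; the identity covariance is conditional on [G]. *)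
Record innovation G k (D : Omega -> 'cV[R]_k) : Prop := {
  innov_sqint : forall i, sqint P (fun w => D w i 0);
  innov_mean : forall i, ccentered P G (fun w => D w i 0);
  innov_cov : forall i j,
    ccentered P G (fun w => D w i 0 * D w j 0 - (i == j)%:R) }.

(** What one step uses of dN_t: conditionally centered and conditionally uncorrelated with dW_t. *)
Record residual G k n (D : Omega -> 'cV[R]_k) (nu : Omega -> 'cV[R]_n) : Prop := {
  resid_sqint : forall i, sqint P (fun w => nu w i 0);
  resid_mean : forall i, ccentered P G (fun w => nu w i 0);
  resid_orth : forall i j, ccentered P G (fun w => nu w i 0 * D w j 0) }.

Lemma innov_sqr G k (D : Omega -> 'cV[R]_k) i : innovation G D ->
  ccentered P G (fun w => D w i 0 ^+ 2 - 1).
Proof.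
by move=> hD; have := innov_cov hD i i; rewrite eqxx; under eq_fun do rewrite -expr2.
Qed.

Lemma innov_sqintM G k (D : Omega -> 'cV[R]_k) Z i : sub_sigma G ->
  innovation G D -> meas_wrt G Z -> sqint P Z ->
  sqint P (fun w => Z w * D w i 0).
Proof.
move=> sG hD mZ sZ; apply: (sqint_meas_wrtM sG mZ sZ).
  exact: (innov_sqint hD i).1.
exact: innov_sqr.
Qed.

Lemma innov_ccenteredM G k (D : Omega -> 'cV[R]_k) Z i : sub_sigma G ->
  innovation G D -> meas_wrt G Z -> sqint P Z ->
  ccentered P G (fun w => Z w * D w i 0).
Proof.
move=> sG hD mZ sZ; apply: ccenteredM => //; first exact: innov_mean.
by apply: sqint_L1; exact: innov_sqintM hD mZ sZ.
Qed.

(** Integrability depends on the grouping: [Z * D_i] is square integrable by the unit conditional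
    variance, so [(Z * D_i) * D_j] is a product of two L^2 variables. *)
Lemma innov_cov_ccenteredM G k (D : Omega -> 'cV[R]_k) Z i j : sub_sigma G ->
  innovation G D -> meas_wrt G Z -> sqint P Z ->
  ccentered P G (fun w => Z w * (D w i 0 * D w j 0 - (i == j)%:R)).
Proof.
move=> sG hD mZ sZ; apply: ccenteredM => //; first exact: innov_cov.
under eq_fun do rewrite mulrBr mulrA.
apply: L1B.
  by apply: sqintM; [exact: innov_sqintM hD mZ sZ|exact: innov_sqint hD j].
by under eq_fun do rewrite mulrC; apply: L1Z; exact: sqint_L1.
Qed.

Lemma sum_mul_delta k (a : 'I_k -> R) j : \sum_i a i * (i == j)%:R = a j.
Proof.
rewrite (bigD1 j)//= eqxx mulr1 big1 ?addr0// => i /negPf ->.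
exact: mulr0.
Qed.

Lemma decomposition_exists G k n (D : Omega -> 'cV[R]_k) (X : Omega -> 'cV[R]_n) :
  sub_sigma G -> innovation G D -> (forall i, sqint P (fun w => X w i 0)) ->
  exists (y : Omega -> 'cV[R]_n) (z : Omega -> 'M[R]_(n, k)),
    [/\ L2 P G y, L2 P G z & residual G D (fun w => X w - y w - z w *m D w)].
Proof.
move=> sG hD sX.
have /choice[y hy] : forall i : 'I_n, exists y, [/\ meas_wrt G y, sqint P y &
    ccentered P G (fun w => X w i 0 - y w)].
  move=> i; have [y [my iy cy]] := condexp_exists sG (sqint_L1 (sX i)).
  (* The Cauchy-Schwarz bound with [D = 1] is the L^2 contraction property of conditional
     expectation. *)
  exists y; split => //; apply: (sqint_condexp sG (sX i) (sqint_cst P 1) _ my).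
    by under eq_fun do rewrite expr1n subrr; exact: ccentered0.
  by under eq_fun do rewrite mulr1.
have /choice[z hz] : forall ij : 'I_n * 'I_k, exists z, [/\ meas_wrt G z, sqint P z &
    ccentered P G (fun w => X w ij.1 0 * D w ij.2 0 - z w)].
  move=> [i j] /=.
  have [z [mz iz cz]] := condexp_exists sG (sqintM (sX i) (innov_sqint hD j)).
  exists z; split => //.
  exact: (sqint_condexp sG (sX i) (innov_sqint hD j) (innov_sqr j hD) mz cz).
exists (fun w => \col_i y i w), (fun w => \matrix_(i, j) z (i, j) w).
have mz i j : meas_wrt G (z (i, j)) by have [] := hz (i, j).
have sz i j : sqint P (z (i, j)) by have [] := hz (i, j).
have my i : meas_wrt G (y i) by have [] := hy i.
have sy i : sqint P (y i) by have [] := hy i.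
have nuE i w : (X w - (\col_i y i w) - (\matrix_(i, j) z (i, j) w) *m D w) i 0 =
    X w i 0 - y i w - \sum_j z (i, j) w * D w j 0.
  by rewrite !mxE; congr (_ - _); apply: eq_bigr => j _; rewrite mxE.
split.
- apply/(L2P _ _ sG); split => i j.
    by apply: eq_measurable_fun (my i) => w _; rewrite mxE.
  by congr (sqint _ _): (sy i); apply/funext => w; rewrite mxE.
- apply/(L2P _ _ sG); split => i j.
    by apply: eq_measurable_fun (mz i j) => w _; rewrite mxE.
  by congr (sqint _ _): (sz i j); apply/funext => w; rewrite mxE.
split => [i|i|i j]; under eq_fun do rewrite nuE.
- apply: sqintB; first exact: sqintB.
  by apply: sqint_sum => j; exact: innov_sqintM hD _ _.
- apply: ccenteredB => //; first by have [] := hy i.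
  by apply: ccentered_sum => // j; exact: innov_ccenteredM.
(* With nu the residual, nu_i D_j = (X_i D_j - z_ij) - y_i D_j - sum_l z_il (D_l D_j - delta_lj), a
   combination of centered terms. *)
- have [_ _ cz] := hz (i, j).
  have := ccenteredB sG (ccenteredB sG cz (innov_ccenteredM j sG hD (my i) (sy i)))
    (ccentered_sum (index_enum 'I_k) sG
       (fun l => innov_cov_ccenteredM l j sG hD (mz i l) (sz i l))).
  congr (ccentered _ _ _); apply/funext => w /=.
  under eq_bigr do rewrite mulrBr.
  rewrite sumrB sum_mul_delta 2!mulrBl mulr_suml.
  under eq_bigr do rewrite mulrA.
  ring.
Qed.

(** By linearity it suffices to decompose zero. Conditioning on [G] leaves only y; multiplying by
    D_j before conditioning leaves column j of z. Both are G-measurable and centered, hence null. *)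
Lemma decomposition_unique G k n (D : Omega -> 'cV[R]_k)
    (y : Omega -> 'cV[R]_n) (z : Omega -> 'M[R]_(n, k)) (nu : Omega -> 'cV[R]_n) :
  sub_sigma G -> innovation G D -> L2 P G y -> L2 P G z -> residual G D nu ->
  {ae P, forall w, y w + z w *m D w + nu w = 0} ->
  [/\ {ae P, forall w, y w = 0}, {ae P, forall w, z w = 0} &
      {ae P, forall w, nu w = 0}].
Proof.
move=> sG hD /(L2P _ _ sG)[my sy] /(L2P _ _ sG)[mz sz] hnu eq0.
have eq0i i : {ae P, forall w,
    y w i 0 + \sum_j z w i j * D w j 0 + nu w i 0 = 0}.
  by apply: filterS eq0 => w /matrixP/(_ i 0); rewrite !mxE.
have y0 i : {ae P, forall w, y w i 0 = 0}.
  apply: (ccentered_eq0 sG) => //; last exact: my.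
  have cS := ccentered_sum (index_enum 'I_k) sG
       (fun l => innov_ccenteredM l sG hD (mz i l) (sz i l)).
  apply: (ccentered_ae sG _ _ (ccenteredB sG
    (ccenteredB sG (ccentered0 P G) cS) (resid_mean hnu i))).
    exact: (sy i 0).1.
  by apply: filterS (eq0i i) => w /=; lra.
have z0 i j : {ae P, forall w, z w i j = 0}.
  apply: (ccentered_eq0 sG) => //; last exact: mz.
  have cS := ccentered_sum (index_enum 'I_k) sG
       (fun l => innov_cov_ccenteredM l j sG hD (mz i l) (sz i l)).
  have cy := innov_ccenteredM j sG hD (my i 0) (sy i 0).
  apply: (ccentered_ae sG _ _ (ccenteredB sG
    (ccenteredB sG (ccenteredB sG (ccentered0 P G) cS) cy) (resid_orth hnu i j))).
    exact: (sz i j).1.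
  apply: filterS (eq0i i) => w /= /(congr1 ( *%R^~ (D w j 0))).
  rewrite mul0r 2!mulrDl mulr_suml => e.
  under eq_bigr do rewrite mulrBr mulrA.
  rewrite sumrB sum_mul_delta; lra.
have y00 : {ae P, forall w, y w = 0}.
  apply: filterS (@filter_forall _ _ (fun i w => y w i 0 = 0) _ _ y0) => w H.
  by apply/matrixP => i j; rewrite (ord1 j) H mxE.
have z00 : {ae P, forall w, z w = 0}.
  have : {ae P, forall w, forall i j, z w i j = 0}.
    by apply: filter_forall => i; apply: filter_forall => j; exact: z0.
  apply: filterS => w H.
  by apply/matrixP => i j; rewrite H mxE.
split => //; apply: filterS3 eq0 y00 z00 => w e y0w z0w.
by move: e; rewrite y0w z0w mul0mx !add0r.
Qed.

Lemma residual_product G k n (D W W' : Omega -> 'cV[R]_k)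
    (nu N N' : Omega -> 'cV[R]_n) i j :
  sub_sigma G -> L2 P G W -> L2 P G N ->
  (forall i, sqint P (fun w => D w i 0)) ->
  (forall i, ccentered P G (fun w => D w i 0)) ->
  (forall i, sqint P (fun w => nu w i 0)) ->
  (forall i, ccentered P G (fun w => nu w i 0)) ->
  W' = (fun w => W w + D w) -> N' = (fun w => N w + nu w) ->
  ccentered P G (fun w => nu w i 0 * D w j 0) <->
  ccentered P G (fun w => (N' w *m (W' w)^T) i j - (N w *m (W w)^T) i j).
Proof.
move=> sG /(L2P _ _ sG)[mW sW] /(L2P _ _ sG)[mN sN] sD cD snu cnu -> ->.
have c1 : ccentered P G (fun w => N w i 0 * D w j 0).
  by apply: ccenteredM => //; [exact: mN|exact: sqintM].
have c2 : ccentered P G (fun w => W w j 0 * nu w i 0).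
  by apply: ccenteredM => //; [exact: mW|exact: sqintM].
have e w : ((N w + nu w) *m (W w + D w)^T) i j - (N w *m (W w)^T) i j =
    N w i 0 * D w j 0 + W w j 0 * nu w i 0 + nu w i 0 * D w j 0.
  by rewrite !mxE !big_ord1 !mxE; ring.
under [X in _ <-> ccentered _ _ X]eq_fun do rewrite e.
split=> [c3|c3]; first by apply: ccenteredD => //; exact: ccenteredD.
have := ccenteredB sG c3 (ccenteredD sG c1 c2).
by congr (ccentered _ _ _); apply/funext => w; ring.
Qed.

(** M_t - M_s telescopes into one-step increments, each centered given F_s by the tower property. *)
Lemma martingale_step F T m n (M : nat -> Omega -> 'M[R]_(m, n)) :
  (forall t, (t <= T)%N -> sub_sigma (F t)) ->
  (forall s t, (s <= t)%N -> F s `<=` F t) ->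
  (forall t, (t <= T)%N -> measurable_wrt (F t) (M t)) ->
  (forall t, (t <= T)%N -> mx_integrable P (M t)) ->
  (forall t, (t < T)%N -> forall i j,
     ccentered P (F t) (fun w => M t.+1 w i j - M t w i j)) ->
  martingale P F T M.
Proof.
move=> sF Fle mM iM cM; split => // s t /andP[st tT].
apply/is_condexpP; first by apply: sF; exact: leq_trans tT.
split; [exact: iM|by apply: iM; exact: leq_trans tT|by apply: mM; exact: leq_trans tT|].
move=> i j; have sT := leq_trans st tT.
elim: t st tT => [|t IHt].
  by rewrite leqn0 => /eqP -> _; under eq_fun do rewrite subrr; exact: ccentered0.
rewrite leq_eqVlt => /predU1P[<- _|].
  by under eq_fun do rewrite subrr; exact: ccentered0.
rewrite ltnS => st tT.
have := ccenteredD (sF s sT) (ccentered_sub (Fle s t st) (cM t tT i j)) (IHt st (ltnW tT)).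
by congr (ccentered _ _ _); apply/funext => w; ring.
Qed.

End OneStep.

(** * The backward equation *)

Section BackwardEquation.
Context (R : realType) (dO : measure_display) (Omega : measurableType dO).
Context (P : probability Omega R) (T n d : nat) (W : nat -> Omega -> 'cV[R]_d).
Local Notation F := (completed_filtration P W).
Hypothesis FT_full : @measurable dO Omega = F T.
Hypothesis W_driving : driving_martingale P F T W.

Lemma filtration_mono s t : (s <= t)%N -> F s `<=` F t.
Proof.
move=> st; apply: sub_sigma_algebra2; apply: setSU.
by move=> A [k /= ks WA]; exists k => //=; exact: leq_trans st.
Qed.

(** [FT_full] makes the adjoined negligible sets measurable: F_t is contained in F_T, the ambient
    sigma-algebra. *)
Lemma filtration_complete t : (t <= T)%N -> complete_sub P (F t).
Proof.
move=> tT; split; first split.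
- exact: smallest_sigma_algebra.
- by rewrite FT_full; exact: filtration_mono.
- by move=> N nN; apply: sub_sigma_algebra; right.
Qed.

Lemma filtration_sub t : (t <= T)%N -> sub_sigma (F t).
Proof. by move=> /filtration_complete[]. Qed.

Lemma sqint_driving t i : (t <= T)%N -> sqint P (fun w => W t w i 0).
Proof.
move=> tT; have := driving_M2 W_driving; rewrite /M2 => /(_ t tT).
by move=> /(L2P _ _ (filtration_sub tT))[_]; apply.
Qed.

(** The products of entries of dW_t are measurable for its own sigma-algebra, so independence of F_t
    upgrades the covariance from an identity in mean to a conditional one. *)
Lemma driving_innovation t : (t < T)%N -> innovation P (F t) (increment W t).
Proof.
move=> tT; have sF := filtration_sub (ltnW tT).
have sD i : sqint P (fun w => increment W t w i 0).
  have -> : (fun w => increment W t w i 0) = fun w => W t.+1 w i 0 - W t w i 0.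
    by apply/funext => w; rewrite !mxE.
  by apply: sqintB; apply: sqint_driving => //; exact: ltnW.
split => // [i|i j].
  have /(is_condexpP _ _ _ sF)[_ _ _ /(_ i 0)] := driving_condexp W_driving tT.
  by congr (ccentered _ _ _); apply/funext => w; rewrite [X in _ - X]mxE subr0.
pose H := sigma_of (increment W t).
have sH : sub_sigma H.
  split; first exact: smallest_sigma_algebra.
  apply: smallest_sub; first exact: sigma_algebra_measurable.
  move=> _ [k [l [B mB ->]]]; rewrite (ord1 l) -[_ @^-1` _]setTI.
  exact: (sD k).1 measurableT _ mB.
have mH k : meas_wrt H (fun w => increment W t w k 0).
  apply: meas_wrtP => // B mB; apply: sub_sigma_algebra.
  by exists k, 0, B.
apply: (ccentered_indep sF sH (driving_indep W_driving tT)).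
- exact: meas_wrtM.
- exact: sqintM.
have := driving_cov W_driving tT i j; rewrite unlock mxE => <-.
by apply: eq_integral => w _; rewrite !mxE big_ord1 !mxE.
Qed.

Lemma solution_residual (f : Omega -> nat -> 'cV[R]_n -> 'M[R]_(n, d) -> 'cV[R]_n)
    eta Y Z N t :
  bsde_solution P F T W f eta Y Z N -> (t < T)%N ->
  residual P (F t) (increment W t) (increment N t).
Proof.
move=> sol tT; have sF := filtration_sub (ltnW tT).
have LN s : (s <= T)%N -> L2 P (F s) (N s) by move=> sT; exact: (sol_N sol).
have sN s i : (s <= T)%N -> sqint P (fun w => N s w i 0).
  by move=> sT; have /(L2P _ _ (filtration_sub sT))[] := LN s sT.
have snu i : sqint P (fun w => increment N t w i 0).
  have -> : (fun w => increment N t w i 0) = fun w => N t.+1 w i 0 - N t w i 0.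
    by apply/funext => w; rewrite !mxE.
  by apply: sqintB; apply: sN => //; exact: ltnW.
have st : (t <= t.+1 <= T)%N by rewrite leqnSn.
have cnu i : ccentered P (F t) (fun w => increment N t w i 0).
  have [_ _ /(_ t t.+1 st)/(is_condexpP _ _ _ sF)[_ _ _ /(_ i 0)]] := sol_N_martingale sol.
  by congr (ccentered _ _ _); apply/funext => w; rewrite !mxE.
split => // i j.
have hD := driving_innovation tT.
apply/(residual_product (W := W t) (N := N t) (W' := W t.+1) (N' := N t.+1) i j sF
   _ _ (innov_sqint hD) (innov_mean hD) snu cnu).
- exact: (driving_M2 W_driving (ltnW tT)).
- exact/LN/ltnW.
- by apply/funext => w; rewrite /increment addrC subrK.
- by apply/funext => w; rewrite /increment addrC subrK.
by have [_ _ /(_ t t.+1 st)/(is_condexpP _ _ _ sF)[_ _ _ ]] := sol_N_orthogonal sol.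
Qed.

(** * Uniqueness by backward induction *)

Section Driver.
Variable eta : Omega -> 'cV[R]_n.
Variable f : Omega -> nat -> 'cV[R]_n -> 'M[R]_(n, d) -> 'cV[R]_n.
Variable c1 : R.
Hypothesis T_ge1 : (1 <= T)%N.
Hypothesis A1_T : {ae P, forall w, forall y1 y2 z1 z2,
   frobenius (f w T y1 z1 - f w T y2 z2) <= c1 * frobenius (y1 - y2)}.

(** Taking [y1 = y2] in the bound makes its right side vanish. This renders the unconstrained value
    Z_T harmless. *)
Lemma driver_T_indep : {ae P, forall w, forall y z z', f w T y z = f w T y z'}.
Proof.
apply: filterS A1_T => w h y z z'; apply/subr0_eq/frobenius_le0.
by have := h y y z z'; rewrite subrr frobenius0 mulr0.
Qed.

Lemma solution_unique Y Z N Y' Z' N' :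
  bsde_solution P F T W f eta Y Z N -> bsde_solution P F T W f eta Y' Z' N' ->
  [/\ forall t, (t <= T)%N -> {ae P, forall w, Y t w = Y' t w},
      forall t, (t <= T.-1)%N -> {ae P, forall w, Z t w = Z' t w} &
      forall t, (t <= T)%N -> {ae P, forall w, N t w = N' t w}].
Proof.
move=> sol sol'.
have YT : {ae P, forall w, Y T w = Y' T w}.
  by apply: filterS2 (sol_terminal sol) (sol_terminal sol') => w -> ->.
(* Agreement of Z at t+1 is available only for t+1 < T; at t = T-1 the driver ignores this
   argument. *)
have step t : (t < T)%N -> {ae P, forall w, Y t.+1 w = Y' t.+1 w} ->
    ((t.+1 < T)%N -> {ae P, forall w, Z t.+1 w = Z' t.+1 w}) ->
  [/\ {ae P, forall w, Y t w = Y' t w}, {ae P, forall w, Z t w = Z' t w} &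
      {ae P, forall w, increment N t w = increment N' t w}].
  move=> tT eY eZ; have sF := filtration_sub (ltnW tT).
  have tT1 : (t <= T.-1)%N by rewrite -ltnS prednK.
  have ef : {ae P, forall w, f w t.+1 (Y t.+1 w) (Z t.+1 w) =
                             f w t.+1 (Y' t.+1 w) (Z' t.+1 w)}.
    have := tT; rewrite leq_eqVlt => /predU1P[eT|/eZ eZ'].
      by apply: filterS2 driver_T_indep eY => w h ->; rewrite eT; exact: h.
    by apply: filterS2 eY eZ' => w -> ->.
  have r := solution_residual sol tT; have r' := solution_residual sol' tT.
  have rB : residual P (F t) (increment W t)
      (fun w => increment N t w - increment N' t w).
    split=> [i|i|i j].
    - congr (sqint _ _): (sqintB (resid_sqint r i) (resid_sqint r' i)).
      by apply/funext => w; rewrite !mxE.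
    - congr (ccentered _ _ _): (ccenteredB sF (resid_mean r i) (resid_mean r' i)).
      by apply/funext => w; rewrite !mxE.
    - congr (ccentered _ _ _): (ccenteredB sF (resid_orth r i j) (resid_orth r' i j)).
      by apply/funext => w; rewrite !mxE -mulrBl.
  have [] := decomposition_unique sF (driving_innovation tT)
    (L2B sF (sol_Y sol (ltnW tT)) (sol_Y sol' (ltnW tT)))
    (L2B sF (sol_Z sol tT1) (sol_Z sol' tT1)) rB.
    apply: filterS (filterI (filterI (sol_eq sol tT) (sol_eq sol' tT))
                            (filterI eY ef)) => w [[e e'] [eYw efw]].
    have -> : Y t w = Y t.+1 w - increment Y t w by rewrite /increment opprB addrC subrK.
    have -> : Y' t w = Y' t.+1 w - increment Y' t w by rewrite /increment opprB addrC subrK.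
    rewrite e e' efw eYw mulmxBl.
    apply/matrixP => i j; rewrite !mxE; ring.
  move=> y0 z0 nu0; split.
  - by apply: filterS y0 => w /subr0_eq.
  - by apply: filterS z0 => w /subr0_eq.
  - by apply: filterS nu0 => w /subr0_eq.
(* The induction is on the time k remaining until T; at k = 0 the clause on Z and dN is vacuous. *)
have all k t : T = (t + k)%N -> {ae P, forall w, Y t w = Y' t w} /\
   ((t < T)%N -> {ae P, forall w, Z t w = Z' t w} /\
      {ae P, forall w, increment N t w = increment N' t w}).
  elim: k t => [t|k IHk t Tk].
    by rewrite addn0 => <-; split => //; rewrite ltnn.
  have tT : (t < T)%N by rewrite Tk addnS ltnS leq_addr.
  have [eY eZN] := IHk t.+1 (eq_trans Tk (addnS t k)).
  by have [] := step t tT eY (fun h => (eZN h).1); split.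
have allT t : (t <= T)%N -> T = (t + (T - t))%N by move=> tT; rewrite subnKC.
split => [t tT|t tT|t].
- by have [] := all _ t (allT t tT).
- have tT' : (t < T)%N by rewrite -(prednK T_ge1) ltnS.
  by have [_ /(_ tT')[]] := all _ t (allT t (ltnW tT')).
(* Y and Z are identified backwards from T, but N is recovered forwards, by summing its increments
   from N_0 = 0. *)
elim: t => [_|t IHt tT].
  by apply: filterS2 (sol_N0 sol) (sol_N0 sol') => w -> ->.
have [_ /(_ tT)[_ eN]] := all _ t (allT t (ltnW tT)).
apply: filterS2 eN (IHt (ltnW tT)) => w; rewrite /increment => e1 e2.
by rewrite -(subrK (N t w) (N t.+1 w)) e1 e2 subrK.
Qed.

End Driver.
End BackwardEquation.

(** * Existence by backward recursion *)

Section Existence.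
Context (R : realType) (dO : measure_display) (Omega : measurableType dO).
Context (P : probability Omega R) (T n d : nat) (W : nat -> Omega -> 'cV[R]_d).
Local Notation F := (completed_filtration P W).
Hypothesis FT_full : @measurable dO Omega = F T.
Hypothesis W_driving : driving_martingale P F T W.
Variables (eta : Omega -> 'cV[R]_n).
Hypothesis eta_L2 : L2 P (F T) eta.
Variable f : Omega -> nat -> 'cV[R]_n -> 'M[R]_(n, d) -> 'cV[R]_n.
Hypothesis f_L2 : forall t, (1 <= t <= T)%N -> forall y z,
  L2 P (F t) y -> L2 P (F t) z -> L2 P (F t) (fun w => f w t (y w) (z w)).

Local Notation state := ((Omega -> 'cV[R]_n) * (Omega -> 'M[R]_(n, d)))%type.

(** The increment dN_t, solved for in the equation. *)
Definition step_residual t (s s' : state) w : 'cV[R]_n :=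
  s.1 w + f w t.+1 (s.1 w) (s.2 w) - s'.1 w - s'.2 w *m increment W t w.

Definition step_rel t (s s' : state) :=
  [/\ L2 P (F t) s'.1, L2 P (F t) s'.2 &
      residual P (F t) (increment W t) (step_residual t s s')].

Let sub t (tT : (t <= T)%N) : sub_sigma (F t).
Proof. by have [] := filtration_complete FT_full tT. Qed.

Let L2_next s t p q (A : Omega -> 'M[R]_(p, q)) :
  (s <= t <= T)%N -> L2 P (F s) A -> L2 P (F t) A.
Proof.
move=> /andP[st tT]; apply: (L2_sub (sub (leq_trans st tT)) (sub tT)).
exact: filtration_mono.
Qed.

Lemma step_exists t s : (t < T)%N -> L2 P (F t.+1) s.1 -> L2 P (F t.+1) s.2 ->
  exists s', step_rel t s s'.
Proof.
move=> tT Ly Lz.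
have Lf : L2 P (F t.+1) (fun w => s.1 w + f w t.+1 (s.1 w) (s.2 w)).
  exact: L2D (sub tT) Ly (f_L2 _ Ly Lz).
have /(L2P _ _ (sub tT))[_ sX] := Lf.
have [y [z [Ly' Lz' r]]] := decomposition_exists (sub (ltnW tT))
  (driving_innovation FT_full W_driving tT) (fun i => sX i 0).
by exists (y, z).
Qed.

Lemma backward_exists : exists Y Z,
  [/\ Y T = eta, forall t, (t <= T)%N -> L2 P (F t) (Y t),
      forall t, (t <= T)%N -> L2 P (F t) (Z t) &
      forall t, (t < T)%N -> step_rel t (Y t.+1, Z t.+1) (Y t, Z t)].
Proof.
(* Choice needs a total step function, while a successor is known to exist only for L^2 states;
   elsewhere the state itself is a default. Integrability of the states is proved after the
   recursion is defined. *)
have /choice[step stepP] : forall ts : nat * state, exists s',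
    (exists s', step_rel ts.1 ts.2 s') -> step_rel ts.1 ts.2 s'.
  move=> ts; have [[s' h]|h] := pselect (exists s', step_rel ts.1 ts.2 s').
    by exists s'.
  by exists ts.2.
(* [st k] is the state at time T - k; it starts from eta with the arbitrary value Z_T = 0. *)
pose fix st k : state :=
  if k is k'.+1 then step ((T - k'.+1)%N, st k') else (eta, fun=> 0).
pose S t := st (T - t)%N.
have SS t : (t < T)%N -> S t = step (t, S t.+1).
  by move=> tT; rewrite /S -(subnSK tT) /= subnSK// subKn// ltnW.
have ST : S T = (eta, fun=> 0) by rewrite /S subnn.
have LS k t : T = (t + k)%N -> L2 P (F t) (S t).1 /\ L2 P (F t) (S t).2.
  elim: k t => [t|k IHk t Tk].
    by rewrite addn0 => <-; rewrite ST; split => //; exact: L2_0 (sub _).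
  have tT : (t < T)%N by rewrite Tk addnS ltnS leq_addr.
  have [Ly Lz] := IHk t.+1 (eq_trans Tk (addnS t k)).
  by rewrite SS//; have [] := stepP (t, S t.+1) (step_exists tT Ly Lz).
have LS' t : (t <= T)%N -> L2 P (F t) (S t).1 /\ L2 P (F t) (S t).2.
  by move=> tT; apply: (LS (T - t)%N); rewrite subnKC.
exists (fun t => (S t).1), (fun t => (S t).2); split.
- by rewrite ST.
- by move=> t /LS'[].
- by move=> t /LS'[].
move=> t tT; have [Ly Lz] := LS' _ tT.
rewrite -!surjective_pairing [X in step_rel _ _ X]SS//.
exact: (stepP (t, S t.+1) (step_exists tT Ly Lz)).
Qed.

Lemma solution_exists : exists Y Z N, bsde_solution P F T W f eta Y Z N.
Proof.
have [Y [Z [YT LY LZ YZ]]] := backward_exists.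
pose nu t := step_residual t (Y t.+1, Z t.+1) (Y t, Z t).
pose N t w := \sum_(0 <= s < t) nu s w.
have NS t : N t.+1 = fun w => N t w + nu t w.
  by apply/funext => w; rewrite /N big_nat_recr.
have dN t w : increment N t w = nu t w by rewrite /increment NS addrC addKr.
have r t : (t < T)%N -> residual P (F t) (increment W t) (nu t).
  by move=> tT; have [] := YZ t tT.
have LW t : (t <= T)%N -> L2 P (F t) (W t) by exact: (driving_M2 W_driving).
(* A residual is square integrable by definition, but its F_{t+1}-measurability has to be read off
   its explicit formula. *)
have Lnu t : (t < T)%N -> L2 P (F t.+1) (nu t).
  move=> tT; have sF := sub tT; apply/(L2P _ _ sF); split=> i j; last first.
    by rewrite (ord1 j); exact: (resid_sqint (r t tT)).
  have tt : (t <= t.+1 <= T)%N by rewrite leqnSn.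
  have [mY _] := (L2P _ _ sF).1 (LY t.+1 tT).
  have [mf _] := (L2P _ _ sF).1 (@f_L2 t.+1 tT _ _ (LY t.+1 tT) (LZ t.+1 tT)).
  have [mYt _] := (L2P _ _ sF).1 (L2_next tt (LY t (ltnW tT))).
  have [mZt _] := (L2P _ _ sF).1 (L2_next tt (LZ t (ltnW tT))).
  have [mWt _] := (L2P _ _ sF).1 (L2_next tt (LW t (ltnW tT))).
  have [mW _] := (L2P _ _ sF).1 (LW t.+1 tT).
  have m := meas_wrtB (meas_wrtB (meas_wrtD (mY i j) (mf i j)) (mYt i j))
    (meas_wrt_sum (index_enum 'I_d)
       (fun k => meas_wrtM (mZt i k) (meas_wrtB (mW k j) (mWt k j)))).
  apply: eq_measurable_fun m => w _; rewrite /nu /step_residual/= !mxE.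
  by congr (_ - _); apply: eq_bigr => k _; rewrite !mxE.
have LN t : (t <= T)%N -> L2 P (F t) (N t).
  elim: t => [_|t IHt tT].
    have -> : N 0%N = fun=> 0 by apply/funext => w; rewrite /N big_geq.
    exact: L2_0 (sub _).
  rewrite NS; apply: L2D (sub tT) _ (Lnu t tT).
  by apply: L2_next (IHt (ltnW tT)); rewrite leqnSn.
have NE t : increment N t = nu t by apply/funext => w; exact: dN.
exists Y, Z, N; split.
- by move=> t /andP[_ tT]; exact: LY.
- by move=> t /andP[_ tT]; apply: LZ; exact: leq_trans tT (leq_pred T).
- by move=> t /andP[_ tT]; exact: LN.
- apply: martingale_step => //.
  + exact: filtration_mono.
  + by move=> t tT; have [] := (L2P _ _ (sub tT)).1 (LN t tT).
  + by move=> t tT; exact: L2_mx_integrable (sub tT) (LN t tT).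
  + move=> t tT i j; rewrite (ord1 j).
    congr (ccentered _ _ _): (resid_mean (r t tT) i).
    by apply/funext => w; rewrite -dN !mxE.
- have NW t i j w : (N t w *m (W t w)^T) i j = N t w i 0 * W t w j 0.
    by rewrite !mxE big_ord1 !mxE.
  apply: martingale_step => //.
  + exact: filtration_mono.
  + move=> t tT i j.
    have [mN _] := (L2P _ _ (sub tT)).1 (LN t tT).
    have [mW _] := (L2P _ _ (sub tT)).1 (LW t tT).
    by apply: eq_measurable_fun (meas_wrtM (mN i 0) (mW j 0)) => w _; rewrite NW.
  + move=> t tT i j.
    have [_ sN] := (L2P _ _ (sub tT)).1 (LN t tT).
    have [_ sW] := (L2P _ _ (sub tT)).1 (LW t tT).
    congr (_.-integrable _ _): (sqintM (sN i 0) (sW j 0)).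
    by apply/funext => w /=; rewrite NW.
  + move=> t tT i j; have hD := driving_innovation FT_full W_driving tT.
    apply/(residual_product (nu := nu t) (D := increment W t) (W := W t)
      (N := N t) i j (sub (ltnW tT)) (LW t (ltnW tT)) (LN t (ltnW tT))
      (innov_sqint hD) (innov_mean hD) (resid_sqint (r t tT)) (resid_mean (r t tT))).
    * by apply/funext => w; rewrite /increment addrC subrK.
    * exact: NS.
    * exact: resid_orth (r t tT) i j.
- by apply: aeW => w; rewrite /N big_geq.
- move=> t tT; apply: aeW => w; rewrite dN /nu /step_residual /increment/=.
  apply/matrixP => i j; rewrite !mxE; ring.
- by apply: aeW => w; rewrite YT.
Qed.

End Existence.

Theorem theorem2p4 (R : realType) (dO : measure_display)
    (Omega : measurableType dO) (P : probability Omega R)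
    (T n d : nat) (T_ge1 : (1 <= T)%N)
    (W : nat -> Omega -> 'cV[R]_d)
    (F : nat -> set (set Omega))
    (F_def : F = completed_filtration P W)
    (F0_trivial : trivial_sigma P (F 0%N))
    (FT_full : @measurable dO Omega = F T)
    (W_driving : driving_martingale P F T W)
    (eta : Omega -> 'cV[R]_n) (eta_L2 : L2 P (F T) eta)
    (f : Omega -> nat -> 'cV[R]_n -> 'M[R]_(n, d) -> 'cV[R]_n)
    (f_meas : forall t, (1 <= t <= T)%N -> forall y z,
       measurable_wrt (F t) (fun w => f w t y z))
    (c1 c2 : R) (c1_gt0 : 0 < c1) (c2_gt0 : 0 < c2)
    (A1_T : {ae P, forall w, forall y1 y2 z1 z2,
       frobenius (f w T y1 z1 - f w T y2 z2) <= c1 * frobenius (y1 - y2)})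
    (A1 : forall t, (1 <= t <= T.-1)%N -> {ae P, forall w, forall y1 y2 z1 z2,
       frobenius (f w t y1 z1 - f w t y2 z2)
         <= c1 * frobenius (y1 - y2) + c2 * frobenius (z1 - z2)})
    (A2 : forall t, (1 <= t <= T)%N -> L2 P (F t) (fun w => f w t 0 0)) :
  (exists Y Z N, bsde_solution P F T W f eta Y Z N) /\
  (forall Y Z N Y' Z' N',
     bsde_solution P F T W f eta Y Z N ->
     bsde_solution P F T W f eta Y' Z' N' ->
     [/\ forall t, (t <= T)%N -> {ae P, forall w, Y t w = Y' t w},
         forall t, (t <= T.-1)%N -> {ae P, forall w, Z t w = Z' t w} &
         forall t, (t <= T)%N -> {ae P, forall w, N t w = N' t w}]).
Proof.
subst F; split; last first.
  by move=> Y Z N Y' Z' N'; exact: (solution_unique FT_full W_driving T_ge1 A1_T).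
apply: solution_exists => // t tT y z Ly Lz.
have /andP[t1 tT'] := tT.
apply: (L2_compose (h := fun w => f w t) (filtration_complete FT_full tT')
  (f_meas t tT) (ltW c1_gt0) (ltW c2_gt0) _ (A2 t tT) Ly Lz).
(* At t = T the bound is weakened by the nonnegative term in c2, so that one composition lemma
   covers all times. *)
have := tT'; rewrite leq_eqVlt => /predU1P[->|tT1].
  apply: filterS A1_T => w h y1 y2 z1 z2; apply: le_trans (h y1 y2 z1 z2) _.
  by rewrite lerDl mulr_ge0 ?frobenius_ge0// ltW.
by apply: A1; rewrite t1 -ltnS prednK.
Qed.
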